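(* Suppose the weight sequence $\mathbf{w}$ has type I. Let $v_0$ be a uniformly random vertex of the simply generated tree $\mathcal{T}_n$. Then, as $n\to\infty$ (with $n\equiv 1 \bmod \mathrm{span}(\mathbf{w})$), the pointed tree $(\mathcal{T}_n,v_0)$ converges in distribution to $\mathcal{T}^*$ in the space $\mathfrak{T}^\bullet$.
   Context: A weight sequence $\mathbf{w}=(\omega_k)_{k\ge0}$ consists of non-negative reals with $\omega_0>0$ and $\omega_k>0$ for some $k\ge2$; $\mathrm{span}(\mathbf{w})=\gcd\{i\ge0:\omega_i>0\}$. A plane tree is a rooted tree whose offspring sets are linearly ordered; $d^+_T(v)$ is the outdegree and $\mathrm{h}_T(v)$ the height (distance to root). The weight of a finite plane tree is $\omega(T)=\prod_{v\in T}\omega_{d^+_T(v)}$, and $\mathcal{T}_n$ is a random plane tree with $n$ vertices drawn with probability proportional to its weight (only $n\equiv 1\bmod\mathrm{span}(\mathbf{w})$, $n$ large, are considered). Let $\phi(z)=\sum_k\omega_kz^k$ with radius of convergence $\rho_\phi$, and $\psi(t)=t\phi'(t)/\phi(t)$. If $\rho_\phi>0$ let $\nu=\lim_{t\nearrow\rho_\phi}\psi(t)\in(0,\infty]$. Type I: $\rho_\phi>0$, $\nu\ge1$, and $\tau$ is the unique number with $\psi(\tau)=1$. Type II: $\rho_\phi>0$, $0<\nu<1$, $\tau:=\rho_\phi$. Type III: $\rho_\phi=0$, $\nu:=0$, $\tau:=0$. Let $\xi$ be a random variable with $\Pr{\xi=k}=\pi_k=\tau^k\omega_k/\phi(\tau)$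 (so $\xi=0$ a.s. in type III), $\mu=\mathbb{E}[\xi]=\min(\nu,1)$, and $\mathcal{T}$ a Galton–Watson tree with offspring distribution $\xi$. The size-biased variable $\hat\xi$ takes values in $\mathbb{N}\cup\{\infty\}$ with $\Pr{\hat\xi=k}=k\pi_k$ and $\Pr{\hat\xi=\infty}=1-\mu$. Space $\mathfrak{T}^\bullet$: let $\mathcal{U}^\bullet_\infty$ be the infinite tree with a backward spine $u_0,u_1,\dots$ ($u_i$ parent of $u_{i-1}$), where each $u_i$, $i\ge1$, has infinitely many ordered children to the left and to the right of $u_{i-1}$ (indexed by $\mathbb{Z}\setminus\{0\}$ relative to $u_{i-1}$), each non-spine child and $u_0$ being the root of a copy of the Ulam–Harris tree (vertices = finite sequences of positive integers). A pointed plane tree $(T,v)$ with path $v=v_0,v_1,\dots,v_k$ = root is embedded into $\mathcal{U}^\bullet_\infty$ order- and degree-preservingly with $v_i\mapsto u_i$; more generally, elements of $\mathfrak{T}^\bullet$ are ''trees'' encoded by families $(d^+(x))_{x\in\mathcal{U}^\bullet_\infty}$ with $d^+(x)\in\overline{\mathbb{N}}_0=\mathbb{N}_0\cup\{\infty\}$ for $x\notin\{u_1,u_2,\dots\}$ and $d^+(u_i)\in\{*\}\sqcup(\overline{\mathbb{N}}_0\times\overline{\mathbb{N}}_0)$ for $i\ge1$, where $(a,b)$ gives the numbers of children of $u_i$ to the left and to the right of $u_{i-1}$ and $*$ means $u_i$ is not a vertex (the spine has ended). $\overline{\mathbb{N}}_0$ carries the one-point compactification topology, and $\mathfrak{T}^\bullet$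 (the closed subset of families that describe trees) carries the product topology; it is compact Polish. Convergence in $\mathfrak{T}^\bullet$ means convergence of $d^+(x)$ for every $x$. The limit tree $\mathcal{T}^*$ (type I, where $\hat\xi<\infty$ a.s.): $u_0$ is the root of an independent copy of $\mathcal{T}$; for every $i\ge1$, $u_i$ receives an independent copy of $\hat\xi$ many children, $u_{i-1}$ is identified with a uniformly random one of them, and every other child is the root of an independent copy of $\mathcal{T}$. $\mathcal{T}^*$ is pointed at $u_0$. *)

(* Defs.v *)
From mathcomp Require Import all_boot all_order all_algebra.
From Stdlib Require List.
From mathcomp Require Import all_classical all_reals all_analysis.
Import numFieldNormedType.Exports.
Import Order.TTheory GRing.Theory Num.Theory.

Set Implicit Arguments.
Unset Strict Implicit.
Unset Printing Implicit Defensive.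

Local Open Scope ring_scope.
Local Open Scope classical_set_scope.

Section Weights.
Variable R : realType.
Implicit Types (w : nat -> R) (t : R).

Definition weight_seq w : Prop :=
  (forall k, 0 <= w k) /\ 0 < w 0%N /\ exists k, (2 <= k)%N /\ 0 < w k.

Definition is_span w (d : nat) : Prop :=
  (forall i, 0 < w i -> (d %| i)%N) /\
  (forall d', (forall i, 0 < w i -> (d' %| i)%N) -> (d' %| d)%N).

Definition phi_series w t : R^nat := series (fun k => w k * t ^+ k).
Definition dphi_series w t : R^nat :=
  series (fun k => k%:R * w k * t ^+ k.-1).

Definition phi w t : R := limn (phi_series w t).
Definition dphi w t : R := limn (dphi_series w t).

Definition psi w t : R := t * dphi w t / phi w t.

Definition rho_phi w : \bar R :=
  ereal_sup [set t%:E | t in [set t : R | 0 <= t /\ cvgn (phi_series w t)]].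

Definition nu_is w (nu : \bar R) : Prop :=
  match rho_phi w with
  | r%:E => (psi w t)%:E @[t --> r^'-] --> nu
  | +oo%E => (psi w t)%:E @[t --> +oo] --> nu
  | -oo%E => False
  end.

Definition typeI w : Prop :=
  (0 < rho_phi w)%E /\ exists nu, nu_is w nu /\ (1 <= nu)%E.

Definition is_tau w (tau : R) : Prop :=
  0 < tau /\ cvgn (phi_series w tau) /\ cvgn (dphi_series w tau) /\
  psi w tau = 1.

Definition pi_w w (tau : R) (k : nat) : R := tau ^+ k * w k / phi w tau.

End Weights.

Inductive ptree := Node of seq ptree.

(* Ulam-Harris addresses: a vertex is the sequence of (0-based) child indices
   along the path from the root.  [deg_at s T] is the outdegree of the vertex
   with address s, and 0 if s is not a vertex of T. *)
Fixpoint deg_at (s : seq nat) (T : ptree) {struct s} : nat :=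
  match s with
  | [::] => let: Node ts := T in size ts
  | i :: s' => let: Node ts := T in
               if (i < size ts)%N then deg_at s' (nth (Node [::]) ts i) else 0%N
  end.

Fixpoint addrs (T : ptree) : seq (seq nat) :=
  let: Node ts := T in
  [::] :: (fix aux (i : nat) (l : seq ptree) {struct l} : seq (seq nat) :=
             match l with
             | [::] => [::]
             | t :: l' => map (cons i) (addrs t) ++ aux i.+1 l'
             end) 0%N ts.

Definition tsize (T : ptree) : nat := size (addrs T).

Definition tweight (R : realType) (w : nat -> R) (T : ptree) : R :=
  \prod_(s <- addrs T) w (deg_at s T).

(* enumeration of plane forests with n vertices in total (fuel >= n) *)
Fixpoint forests (fuel n : nat) {struct fuel} : seq (seq ptree) :=
  match fuel with
  | 0%N => if n == 0%N then [:: [::]] else [::]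
  | fuel'.+1 =>
      if n == 0%N then [:: [::]] else
      flatten [seq [seq Node f :: g | f <- forests fuel' k,
                                      g <- forests fuel' (n - k.+1)%N]
              | k <- iota 0 n]
  end.

Definition trees_of_size (n : nat) : seq ptree :=
  match n with
  | 0%N => [::]
  | n'.+1 => [seq Node f | f <- forests n' n']
  end.

Inductive nbar := NFin of nat | NInf.

(* value of d^+(u_i), i >= 1 : * (not a vertex) or a pair (left, right) *)
Inductive sdeg_val := SStar | SPair of nbar & nbar.

(* vertices of U^bullet_infty other than the spine vertices u_1, u_2, ... :
   - [R0 s]          : the vertex with Ulam-Harris address s (0-based) in
                       the Ulam-Harris tree rooted at u_0 ([R0 [::]] = u_0);
   - [RC i l m s]    : the vertex with address s in the Ulam-Harris tree
                       rooted at the child of u_(i+1) with offset -(m+1)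
                       (if l = true, left of u_i) or +(m+1) (if l = false,
                       right of u_i) relative to u_i. *)
Inductive nsv :=
  | R0 of seq nat
  | RC of nat & bool & nat & seq nat.

(* a family of outdegrees: [sdeg c i] is d^+(u_(i+1)), [odeg c x] is d^+(x);
   vertices not belonging to the tree get outdegree 0 (resp. * on the spine) *)
Record conf := Conf { sdeg : nat -> sdeg_val ; odeg : nsv -> nbar }.

(* basic neighbourhoods in the one-point compactification Nbar_0 *)
Definition near_nbar (M : nat) (a a' : nbar) : Prop :=
  match a with
  | NFin k => a' = NFin k
  | NInf => match a' with NInf => True | NFin m => (M <= m)%N end
  end.

Definition near_sdeg (M : nat) (s s' : sdeg_val) : Prop :=
  match s, s' with
  | SStar, SStar => True
  | SPair a b, SPair a' b' => near_nbar M a a' /\ near_nbar M b b'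
  | _, _ => False
  end.

(* continuity for the product topology *)
Definition conf_continuous (R : realType) (f : conf -> R) : Prop :=
  forall (c : conf) (eps : R), 0 < eps ->
  exists (I : seq nat) (X : seq nsv) (M : nat),
    forall c' : conf,
      (forall i, List.In i I -> near_sdeg M (sdeg c i) (sdeg c' i)) ->
      (forall x, List.In x X -> near_nbar M (odeg c x) (odeg c' x)) ->
      `|f c' - f c| < eps.

(* v has address a, |a| = k; v_j = ancestor of v at distance j (address
   take (k - j) a) is mapped to u_j; v_(j-1) is child number nth 0 a (k-j)
   of v_j. *)
Definition pointed_conf (T : ptree) (a : seq nat) : conf :=
  let k := size a in
  Conf
    (fun i => if (i < k)%N then
                let b := take (k - i.+1)%N a in
                let p := nth 0%N a (k - i.+1)%N in
                SPair (NFin p) (NFin (deg_at b T - p.+1)%N)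
              else SStar)
    (fun x => match x with
              | R0 s => NFin (deg_at (a ++ s) T)
              | RC i l m s =>
                  if (i < k)%N then
                    let b := take (k - i.+1)%N a in
                    let p := nth 0%N a (k - i.+1)%N in
                    if l then
                      (if (m < p)%N then NFin (deg_at (b ++ (p - m.+1)%N :: s) T)
                       else NFin 0)
                    else NFin (deg_at (b ++ (p + m.+1)%N :: s) T)
                  else NFin 0
              end).

Definition Tn_expect (R : realType) (w : nat -> R) (n : nat) (f : conf -> R)
  : R :=
  (\sum_(T <- trees_of_size n)
     tweight w T * (n%:R^-1 * \sum_(a <- addrs T) f (pointed_conf T a)))
  / \sum_(T <- trees_of_size n) tweight w T.

(* random data: [xi x] offspring number of the non-spine vertex x;
   [K i] number of children of u_(i+1) (copy of hat xi);
   [J i] position (0-based, from the left) of u_i among them (uniform). *)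
Definition star_conf (Omega : Type) (xi : nsv -> Omega -> nat)
  (K J : nat -> Omega -> nat) (om : Omega) : conf :=
  Conf
    (fun i => SPair (NFin (J i om)) (NFin (K i om - (J i om).+1)%N))
    (fun x => match x with
              | R0 s =>
                  if [forall j : 'I_(size s),
                        (nth 0%N s j < xi (R0 (take j s)) om)%N]
                  then NFin (xi (R0 s) om) else NFin 0
              | RC i l m s =>
                  if (m < (if l then J i om else (K i om - (J i om).+1)%N))%N &&
                     [forall j : 'I_(size s),
                        (nth 0%N s j < xi (RC i l m (take j s)) om)%N]
                  then NFin (xi (RC i l m s) om) else NFin 0
              end).

(* joint law of the random data: all variables are independent, each xi x
   has law pi, and for each i, P(K i = k, J i = j) = k pi_k * (1/k) 1_{j<k}
   (hat xi size-biased, J uniform among the k children) *)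
Definition star_law (R : realType) (d : measure_display)
  (Omega : measurableType d) (P : probability Omega R)
  (pi : nat -> R) (xi : nsv -> Omega -> nat) (K J : nat -> Omega -> nat)
  : Prop :=
  (forall x a, measurable [set om | xi x om = a]) /\
  (forall i k j, measurable [set om | K i om = k /\ J i om = j]) /\
  forall (sx : seq (nsv * nat)) (sk : seq (nat * (nat * nat))),
    List.NoDup (map fst sx) -> uniq (map fst sk) ->
    P ([set om | forall p, List.In p sx -> xi p.1 om = p.2] `&`
       [set om | forall q, List.In q sk ->
                   K q.1 om = q.2.1 /\ J q.1 om = q.2.2]) =
    ((\prod_(p <- sx) pi p.2) *
     (\prod_(q <- sk) (q.2.1%:R * pi q.2.1 *
                         (if (q.2.2 < q.2.1)%N then q.2.1%:R^-1 else 0))))%:E.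

Definition conv_in_dist (R : realType) (w : nat -> R) (d : nat)
  (E : (conf -> R) -> R) : Prop :=
  forall f : conf -> R, conf_continuous f ->
    (exists B : R, forall c, `|f c| <= B) ->
    forall eps : R, 0 < eps -> exists N : nat, forall n : nat,
      (N <= n)%N -> n = 1%N %[mod d] -> `|Tn_expect w n f - E f| < eps.

(* Main.v *)
(** Only a lower bound on fringe probabilities is needed.  Rescaling by [tau]
    replaces the weights by a critical offspring law [p], under which [T*] has
    extended fringe [(t, a)] at [u_h] with probability [p(t)], the Galton-Watson
    weight of [t]; by criticality these probabilities add up to 1 for each [h].
    So it suffices that a uniform vertex of [T_n] has fringe subtree [t] with
    asymptotic probability at least [p(t)].

    For this, weight every copy of [t] by [x < 1].  The generating function [Y]
    of the weighted trees satisfies [Y = z Phi(Y) - (1 - x) z^|t| p(t)], for which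
    the constant 1 is a supersolution at [z = 1 + (1 - x) p(t)]; hence
    [E(x^N_t(T_n)) Z_n <= z^-n], where [Z_n] is the partition function and [N_t]
    counts the copies of [t].  By Jensen's inequality [E(N_t(T_n)) / n] is
    asymptotically at least [p(t)], provided that [Z_n] does not decay
    exponentially.  Since [Phi(y) >= y] for a critical law, [y >= x Phi(y)] has no
    finite solution when [x > 1], so [sum_n Z_n x^n = oo]; supermultiplicativity
    of [Z] then gives the lower bound along all large [n = 1 mod d]. *)

From HB Require Import structures.
Require Import Defs.
From mathcomp Require Import all_boot all_order all_algebra.
From mathcomp Require Import all_classical all_reals all_analysis.
From mathcomp Require Import measurable_realfun.
From mathcomp Require Import ring lra zify.
(* [Defs] is imported again because [tuple.tsize] hides [Defs.tsize]. *)
Import Defs numFieldNormedType.Exports.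
Import Order.TTheory GRing.Theory Num.Theory.

Set Implicit Arguments.
Unset Strict Implicit.
Unset Printing Implicit Defensive.

Local Open Scope ring_scope.
Local Open Scope classical_set_scope.

HB.instance Definition _ := gen_eqMixin ptree.
HB.instance Definition _ := gen_eqMixin nsv.

(** * Lists *)

Lemma uniq_flatten_map (T U : eqType) (F : T -> seq U) (key : U -> T)
    (s : seq T) :
  uniq s -> (forall x, x \in s -> uniq (F x)) ->
  (forall x u, x \in s -> u \in F x -> key u = x) ->
  uniq (flatten (map F s)).
Proof.
elim: s => [//|x s IH] /= /andP[xs us] uF keyF.
rewrite cat_uniq uF ?mem_head//= IH //; last first.
- by move=> y u ys; apply: keyF; rewrite inE ys orbT.
- by move=> y ys; apply: uF; rewrite inE ys orbT.
rewrite andbT; apply/hasPn => u /flatten_mapP[y ys uy]; apply/negP => ux.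
have xu := keyF x u (mem_head _ _) ux.
have yu : key u = y by apply: keyF uy; rewrite inE ys orbT.
by move: xs; rewrite -xu yu ys.
Qed.

Lemma big_subseq_le (R : realType) (T : eqType) (A B : seq T) (g : T -> R) :
  uniq A -> {subset A <= B} -> (forall x, 0 <= g x) ->
  \sum_(x <- A) g x <= \sum_(x <- B) g x.
Proof.
move=> uA AB g0.
have /= pAB : perm_eq A [seq x <- undup B | x \in A].
  apply: uniq_perm => //; first by rewrite filter_uniq// undup_uniq.
  move=> x; rewrite mem_filter mem_undup.
  by case: (boolP (x \in A)) => // /AB ->.
rewrite (perm_big _ pAB) big_filter.
apply: (@le_trans _ _ (\sum_(x <- undup B) g x)).
  by rewrite [leRHS](bigID (mem A))/= lerDl sumr_ge0.
elim: B {AB pAB} => [|b B IH]; first by rewrite big_nil.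
rewrite /= big_cons; case: ifP => _; last by rewrite big_cons lerD2l.
by apply: le_trans IH _; rewrite lerDr.
Qed.

(** At most one indicator is nonzero, so the sum is either 0 or a single value of [c]. It serves for
    families of mutually exclusive patterns. *)
Lemma sum_indicator_le (R : realType) (T : eqType) (A : seq T) (b : pred T)
    (c : T -> R) (C : R) :
  uniq A -> 0 <= C ->
  (forall x y, x \in A -> y \in A -> b x -> b y -> x = y) ->
  (forall x, x \in A -> b x -> c x <= C) ->
  \sum_(x <- A) c x * (b x)%:R <= C.
Proof.
move=> uA C0 b1 cC.
have [/hasP[x xA bx]|/hasPn nb] := boolP (has b A).
  rewrite (bigD1_seq x)//= bx mulr1 big_seq_cond big1 ?addr0 ?cC// => y /andP[yA yx].
  case by_ : (b y); last by rewrite mulr0.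
  by move: yx; rewrite (b1 _ _ yA xA by_ bx) eqxx.
by rewrite big_seq big1 // => x xA; rewrite (negPf (nb _ xA)) mulr0.
Qed.

Fixpoint words (T : Type) (k : nat) (A : seq T) : seq (seq T) :=
  if k is k'.+1 then [seq t :: f | t <- A, f <- words k' A] else [:: [::]].

Lemma mem_words (T : eqType) k (A : seq T) f :
  (f \in words k A) = (size f == k) && all (mem A) f.
Proof.
elim: k f => [|k IH] [|t f] //=.
- by apply/negP => /allpairsP[p [_ _]].
rewrite eqSS; apply/allpairsP/idP => [[[u g] /= [uA gw [-> ->]]]|].
  by move: gw; rewrite IH => /andP[-> ->]; rewrite uA.
by case/and3P => sf tA fA; exists (t, f); rewrite /= IH sf fA.
Qed.

Lemma words_uniq (T : eqType) k (A : seq T) : uniq A -> uniq (words k A).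
Proof.
move=> uA; elim: k => [//|k IH] /=.
by apply: allpairs_uniq => // -[x f] [y g] _ _ /= [-> ->].
Qed.

Lemma sum_words (R : realType) (T : Type) k (A : seq T) (g : T -> R) :
  \sum_(f <- words k A) \prod_(t <- f) g t = (\sum_(t <- A) g t) ^+ k.
Proof.
elim: k => [|k IH] /=; first by rewrite big_seq1 big_nil expr0.
rewrite big_allpairs_dep/= exprS big_distrl/=; apply: eq_bigr => t _.
by rewrite -IH big_distrr/=; apply: eq_bigr => f _; rewrite big_cons.
Qed.

(** This is the derivative at s = 0 of [sum_words] for the weight g(t) exp(s u(t)). *)
Lemma sum_words_add (R : realType) (T : Type) k (A : seq T) (g u : T -> R) :
  \sum_(f <- words k A) (\prod_(t <- f) g t) * (\sum_(t <- f) u t) =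
  k%:R * (\sum_(t <- A) g t) ^+ k.-1 * (\sum_(t <- A) g t * u t).
Proof.
elim: k => [|k IH] /=; first by rewrite big_seq1 !big_nil mulr0 !mul0r.
rewrite big_allpairs_dep/=.
under eq_bigr => t _.
  under eq_bigr => f _.
    rewrite !big_cons.
    have -> : g t * \prod_(j <- f) g j * (u t + \sum_(j <- f) u j) =
      g t * u t * (\prod_(j <- f) g j) +
      g t * ((\prod_(j <- f) g j) * (\sum_(j <- f) u j)) by ring.
    over.
  rewrite big_split/= -!big_distrr/= sum_words IH; over.
rewrite big_split/= -!big_distrl/=.
by case: k {IH} => [|k] /=; rewrite ?expr0 ?exprS -?[in RHS]natr1; ring.
Qed.

(** * Plane trees *)

(** The principle generated for [ptree] gives no hypothesis on the trees inside the list of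
    children. *)
Lemma ptree_ind_mem (P : ptree -> Prop) :
  (forall ts, (forall t, t \in ts -> P t) -> P (Node ts)) -> forall T, P T.
Proof.
move=> H; fix IH 1 => -[ts]; apply: H.
elim: ts => [|t ts IHts] u; first by move=> {IH}; rewrite in_nil.
by rewrite inE => /predU1P[->|]; [exact: IH|exact: IHts].
Qed.

(** An address outside the tree yields a single leaf, in agreement with the value 0 of [deg_at]
    there; hence [deg_at_cat] holds without side condition. *)
Fixpoint subtree (s : seq nat) (T : ptree) : ptree :=
  if s is i :: s' then
    let: Node ts := T in subtree s' (nth (Node [::]) ts i)
  else T.

Definition children (T : ptree) : seq ptree := let: Node ts := T in ts.

Lemma deg_at_leaf s : deg_at s (Node [::]) = 0%N.
Proof. by case: s. Qed.

Lemma deg_at_cons i s ts :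
  deg_at (i :: s) (Node ts) = deg_at s (nth (Node [::]) ts i).
Proof.
rewrite /=; case: ltnP => // sts.
by rewrite nth_default // deg_at_leaf.
Qed.

Lemma deg_at_cat b s T : deg_at (b ++ s) T = deg_at s (subtree b T).
Proof. by elim: b T => [|i b IH] [ts]//; rewrite cat_cons deg_at_cons IH. Qed.

Lemma deg_at_subtree s T : deg_at s T = size (children (subtree s T)).
Proof. by rewrite -[s in LHS]cats0 deg_at_cat; case: (subtree s T). Qed.

Lemma deg_at_inj T T' : (forall s, deg_at s T = deg_at s T') -> T = T'.
Proof.
elim/ptree_ind_mem: T T' => ts IH [ts'] E; congr Node.
have Es : size ts = size ts' by exact: (E [::]).
apply: (@eq_from_nth _ (Node [::])) => // i its.
apply: IH => [|s]; first exact: mem_nth.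
by rewrite -!deg_at_cons.
Qed.

Lemma addrs_node ts : addrs (Node ts) =
  [::] :: flatten [seq map (cons i) (addrs (nth (Node [::]) ts i))
                  | i <- iota 0 (size ts)].
Proof.
(* The inner fixpoint of [addrs] carries a running child index, so the claim is generalised over its
   starting value. *)
pose aux := fix aux (i : nat) (l : seq ptree) : seq (seq nat) :=
  if l is t :: l' then map (cons i) (addrs t) ++ aux i.+1 l' else [::].
have auxE l i : aux i l =
  flatten [seq map (cons (i + j)%N) (addrs (nth (Node [::]) l j))
          | j <- iota 0 (size l)].
  elim: l i => [//|t l IH] i /=; rewrite addn0 IH (iotaDl 1 0) -map_comp.
  congr (_ ++ flatten _); apply: eq_map => j /=.
  by rewrite add0n addSnnS.
by rewrite [LHS]/= -/aux; congr cons; exact: (auxE ts 0%N).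
Qed.

Lemma nil_addrs T : [::] \in addrs T.
Proof. by case: T => ts; rewrite addrs_node inE. Qed.

Lemma cons_addrs i s ts : (i :: s \in addrs (Node ts)) =
  (i < size ts)%N && (s \in addrs (nth (Node [::]) ts i)).
Proof.
rewrite addrs_node inE/=; apply/flatten_mapP/andP.
  move=> [j]; rewrite mem_iota => /andP[_ js] /mapP[s' s's' [-> ->]].
  by split.
move=> [iS sa]; exists i; first by rewrite mem_iota.
by apply/mapP; exists s.
Qed.

Lemma addrs_uniq T : uniq (addrs T).
Proof.
elim/ptree_ind_mem: T => ts IH; rewrite addrs_node cons_uniq; apply/andP; split.
  by apply/negP => /flatten_mapP[i _ /mapP[]].
apply: (@uniq_flatten_map _ _ _ (head 0%N)); first exact: iota_uniq.
  move=> i; rewrite mem_iota => /andP[_ its].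
  by rewrite map_inj_uniq => [|x y []//]; apply: IH; exact: mem_nth.
by move=> i u _ /mapP[s _ ->].
Qed.

Lemma cat_addrs b s T :
  (b ++ s \in addrs T) = (b \in addrs T) && (s \in addrs (subtree b T)).
Proof.
elim: b T => [|i b IH] T; first by rewrite nil_addrs.
by case: T => ts; rewrite cat_cons !cons_addrs IH andbA.
Qed.

Lemma rcons_addrs s i T : (rcons s i \in addrs T) =
  (s \in addrs T) && (i < deg_at s T)%N.
Proof.
rewrite -cats1 cat_addrs deg_at_subtree; case: (subtree s T) => ts.
by rewrite cons_addrs nil_addrs andbT.
Qed.

(** The same condition, with [xi] in place of [deg_at], decides in [star_conf] which vertices are
    present. *)
Lemma addrsP s T :
  reflect (forall j, (j < size s)%N -> (nth 0%N s j < deg_at (take j s) T)%N)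
          (s \in addrs T).
Proof.
elim/last_ind: s => [|s i IH]; first by rewrite nil_addrs; apply: ReflectT.
rewrite rcons_addrs size_rcons; apply: (iffP andP).
  move=> [/IH sa id_] j; rewrite ltnS leq_eqVlt => /predU1P[->|js].
    by rewrite nth_rcons ltnn eqxx -cats1 take_size_cat.
  by rewrite nth_rcons js -cats1 takel_cat ?(ltnW js)//; exact: sa.
move=> H; split; last first.
  by have := H (size s) (ltnSn _); rewrite nth_rcons ltnn eqxx -cats1 take_size_cat.
apply/IH => j js; have := H j (ltnW js).
by rewrite nth_rcons js -cats1 takel_cat // ltnW.
Qed.

Lemma deg_at_notin s T : s \notin addrs T -> deg_at s T = 0%N.
Proof.
elim: s T => [|i s IH] [ts]; first by rewrite nil_addrs.
rewrite cons_addrs deg_at_cons negb_and -leqNgt => /orP[le|/IH//].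
by rewrite nth_default// deg_at_leaf.
Qed.

(** A single recursion on the root and its children, which specialises to [tsize], [tweight],
    [ncopies] and [width]. *)
Lemma big_addrs (R : Type) (idx : R) (op : Monoid.law idx) ts
    (F : seq nat -> R) (G : ptree -> seq nat -> R) :
  (forall i s, (i < size ts)%N -> F (i :: s) = G (nth (Node [::]) ts i) s) ->
  \big[op/idx]_(s <- addrs (Node ts)) F s =
  op (F [::]) (\big[op/idx]_(t <- ts) \big[op/idx]_(s <- addrs t) G t s).
Proof.
move=> FG; rewrite addrs_node big_cons big_flatten big_map; congr (op _ _).
rewrite [RHS](big_nth (Node [::])) /index_iota subn0 big_seq [RHS]big_seq.
apply: eq_bigr => i; rewrite mem_iota => /andP[_ its].
by rewrite big_map; apply: eq_bigr => s _; exact: FG.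
Qed.

Lemma tsize_node ts : tsize (Node ts) = (\sum_(t <- ts) tsize t).+1.
Proof.
rewrite /tsize -sum1_size (@big_addrs _ _ _ _ _ (fun _ _ => 1%N))//= add1n.
by congr S; apply: eq_bigr => t _; rewrite sum1_size.
Qed.

Lemma tsize_gt0 T : (0 < tsize T)%N.
Proof. by case: T => ts; rewrite tsize_node. Qed.

Lemma tweight_node (R : realType) (w : nat -> R) ts :
  tweight w (Node ts) = w (size ts) * \prod_(t <- ts) tweight w t.
Proof.
by rewrite /tweight (@big_addrs _ _ _ _ _ (fun t s => w (deg_at s t))) // => i s its;
  rewrite deg_at_cons.
Qed.

Definition ncopies (tau T : ptree) : nat :=
  \sum_(s <- addrs T) (subtree s T == tau).

Lemma ncopies_node tau ts : ncopies tau (Node ts) =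
  ((Node ts == tau) + \sum_(t <- ts) ncopies tau t)%N.
Proof.
by rewrite /ncopies (@big_addrs _ _ _ _ _ (fun t s => subtree s t == tau : nat)).
Qed.

(** Equivalently, the number of vertices at which T can be pointed so that its root becomes u_h. *)
Definition width (h : nat) (T : ptree) : nat :=
  \sum_(s <- addrs T) (size s == h).

Lemma width0 T : width 0 T = 1%N.
Proof.
case: T => ts; rewrite /width (@big_addrs _ _ _ _ _ (fun _ _ => 0%N))//=.
by rewrite big1// => t _; rewrite big1.
Qed.

Lemma widthS h ts : width h.+1 (Node ts) = (\sum_(t <- ts) width h t)%N.
Proof.
by rewrite /width (@big_addrs _ _ _ _ _ (fun t s => size s == h : nat)).
Qed.

Lemma tsize_child ts t : t \in ts -> (tsize t < tsize (Node ts))%N.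
Proof. by move=> tts; rewrite tsize_node (big_rem t)//= ltnS leq_addr. Qed.

Lemma ncopies_small tau T : (tsize T < tsize tau)%N -> ncopies tau T = 0%N.
Proof.
elim/ptree_ind_mem: T => ts IH sT; rewrite ncopies_node.
case: eqP => [E|_]; first by move: sT; rewrite E ltnn.
rewrite big_seq big1// => t tts; apply: IH => //.
exact: ltn_trans (tsize_child tts) sT.
Qed.

(** * Enumeration of forests and trees by size *)

Definition fsize (f : seq ptree) : nat := \sum_(t <- f) tsize t.

Lemma forestsS fuel n : forests fuel.+1 n.+1 =
  flatten [seq [seq Node f :: g | f <- forests fuel k,
                                  g <- forests fuel (n.+1 - k.+1)]
          | k <- iota 0 n.+1].
Proof. by []. Qed.

Lemma mem_forests fuel n f : (n <= fuel)%N ->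
  (f \in forests fuel n) = (fsize f == n).
Proof.
elim: fuel n f => [|fuel IH] [|n] f // nf.
- rewrite /= inE; case: f => [|t f]; first by rewrite /fsize big_nil.
  by rewrite /fsize big_cons; have := tsize_gt0 t; case: (tsize t).
- rewrite /= inE; case: f => [|t f]; first by rewrite /fsize big_nil.
  by rewrite /fsize big_cons; have := tsize_gt0 t; case: (tsize t).
rewrite forestsS; apply/flatten_mapP/idP.
  move=> [k]; rewrite mem_iota.
  move=> /andP[_ kn] /allpairsP[[f1 g]] /= [].
  rewrite !IH; [|lia|lia] => /eqP f1k /eqP gk ->.
  by rewrite /fsize big_cons tsize_node -/(fsize f1) -/(fsize g) f1k gk; apply/eqP; lia.
case: f => [|[f1] g]; first by rewrite /fsize big_nil.
rewrite /fsize big_cons tsize_node -/(fsize f1) -/(fsize g) => /eqP E.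
exists (fsize f1).
  by rewrite mem_iota; lia.
apply/allpairsP; exists (f1, g); rewrite /= !IH; [|lia|lia].
by rewrite eqxx; split=> //; apply/eqP; lia.
Qed.

Lemma forests_uniq fuel n : (n <= fuel)%N -> uniq (forests fuel n).
Proof.
elim: fuel n => [|fuel IH] [|n] // nf.
(* The block k of a forest is recovered as the number of vertices below the root of its first
   tree. *)
rewrite forestsS; apply: (@uniq_flatten_map _ _ _
  (fun f => if f is Node f1 :: _ then fsize f1 else 0%N)).
- exact: (iota_uniq 0 n.+1).
- move=> k; rewrite mem_iota => /andP[_ kn].
  apply: allpairs_uniq; [apply: IH; lia|apply: IH; lia|].
  by move=> [f g] [f' g'] _ _ /= [-> ->].
move=> k u; rewrite mem_iota => /andP[_ kn].
move=> /allpairsP[[f1 g]] /= [+ _ ->].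
by rewrite mem_forests; [move=> /eqP|lia].
Qed.

Lemma mem_trees_of_size n T : (T \in trees_of_size n) = (tsize T == n).
Proof.
case: n => [|n] /=; first by have := tsize_gt0 T; case: (tsize T).
case: T => f; rewrite mem_map => [|x y []//].
by rewrite mem_forests// tsize_node eqSS.
Qed.

Lemma trees_of_size_uniq n : uniq (trees_of_size n).
Proof.
case: n => [//|n] /=; rewrite map_inj_uniq ?forests_uniq// => x y [] //.
Qed.

(* Finite families exhausting all plane trees, over which the sum of a
   multiplicative weight satisfies the exact recursion [sum_boxS_mult]. *)
Fixpoint box (h : nat) : seq ptree :=
  if h is h'.+1 then
    flatten [seq map Node (words k (box h')) | k <- iota 0 h]
  else [::].

Arguments box : simpl never.

Lemma boxS h : box h.+1 =
  flatten [seq map Node (words k (box h)) | k <- iota 0 h.+1].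
Proof. by []. Qed.

Lemma mem_boxS h ts : (Node ts \in box h.+1) =
  (size ts <= h)%N && all (mem (box h)) ts.
Proof.
rewrite boxS; apply/flatten_mapP/andP.
  move=> [k]; rewrite mem_iota => /andP[_ kh].
  rewrite mem_map => [|x y []//]; rewrite mem_words => /andP[/eqP -> ->].
  by [].
move=> [tsh tsb]; exists (size ts).
  by rewrite mem_iota.
by rewrite mem_map => [|x y []//]; rewrite mem_words eqxx.
Qed.

Lemma box_uniq h : uniq (box h).
Proof.
elim: h => [//|h IH]; rewrite boxS.
apply: (@uniq_flatten_map _ _ _ (fun T => size (children T))).
- exact: (iota_uniq 0 h.+1).
- by move=> k _; rewrite map_inj_uniq ?words_uniq// => x y [].
by move=> k u _ /mapP[f]; rewrite mem_words => /andP[/eqP <- _] ->.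
Qed.

Lemma box_mono h h' : (h <= h')%N -> {subset box h <= box h'}.
Proof.
elim: h h' => [//|h IH] [//|h']; rewrite ltnS => hh' [ts].
rewrite !mem_boxS => /andP[s1 /allP a1]; rewrite (leq_trans s1 hh')/=.
by apply/allP => t /a1; exact: IH.
Qed.

(** The size bounds both the outdegrees and the height, the two quantities that [box] truncates. *)
Lemma mem_box T : T \in box (tsize T).
Proof.
elim/ptree_ind_mem: T => ts IH; rewrite tsize_node mem_boxS; apply/andP; split.
  elim: ts {IH} => [//|t ts IHs]; rewrite big_cons /=.
  by have := tsize_gt0 t; move: IHs; lia.
apply/allP => t tts; apply: (@box_mono (tsize t)); last exact: IH.
by rewrite (big_rem t)//= leq_addr.
Qed.

Lemma sum_boxS (R : realType) h (F : ptree -> R) :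
  \sum_(T <- box h.+1) F T =
  \sum_(k < h.+1) \sum_(f <- words k (box h)) F (Node f).
Proof.
rewrite boxS big_flatten big_map.
rewrite -[iota 0 h.+1]/(index_iota 0 h.+1) big_mkord.
by apply: eq_bigr => k _; rewrite big_map.
Qed.

Lemma sum_boxS_mult (R : realType) h (c : nat -> R) (F g : ptree -> R) :
  (forall ts, F (Node ts) = c (size ts) * \prod_(t <- ts) g t) ->
  \sum_(T <- box h.+1) F T = \sum_(k < h.+1) c k * (\sum_(T <- box h) g T) ^+ k.
Proof.
move=> FE; rewrite sum_boxS; apply: eq_bigr => k _.
rewrite -sum_words big_distrr/= big_seq [RHS]big_seq.
by apply: eq_bigr => f; rewrite mem_words FE => /andP[/eqP -> _].
Qed.

(** * Critical offspring distributions *)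

Section Critical.
Variable R : realType.
Implicit Types (p : nat -> R) (x y : R).

Definition critical p : Prop :=
  [/\ forall k, 0 <= p k, 0 < p 0%N, exists2 k, (2 <= k)%N & 0 < p k,
      series p @ \oo --> (1 : R) &
      series (fun k => k%:R * p k) @ \oo --> (1 : R)].

Lemma critical_psum_le1 p n : critical p -> \sum_(k < n) p k <= 1.
Proof.
move=> [p0 _ _ cp _].
have nd : nondecreasing_seq (series p) by apply/nondecreasing_seqP => m;
  rewrite seriesSr lerDl.
have /= := nondecreasing_cvgn_le nd (cvgP _ cp) n.
by rewrite (cvg_lim _ cp)// /series/= big_mkord.
Qed.

Lemma tangent_at1 y k : 0 <= y -> 1 + k%:R * (y - 1) <= y ^+ k.
Proof.
move=> y0; elim: k => [|k IH]; first by rewrite mul0r addr0.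
rewrite exprS -natr1.
have : 0 <= k%:R * (y - 1) ^+ 2 by rewrite mulr_ge0// sqr_ge0.
by move: (ler_wpM2l y0 IH); nra.
Qed.

Lemma tangent_at1_strict y k : 0 <= y -> y != 1 -> (2 <= k)%N ->
  1 + k%:R * (y - 1) < y ^+ k.
Proof.
case: k => [//|[//|k]] y0 y1 _.
have IH := tangent_at1 k.+1 y0.
rewrite exprS -natr1.
have : 0 < k.+1%:R * (y - 1) ^+ 2.
  by rewrite mulr_gt0// exprn_even_gt0//= subr_eq0.
by move: (ler_wpM2l y0 IH); nra.
Qed.

(** Averaging the tangents of y^k at 1 against [p] gives Phi(y) >= 1 + (y - 1) = y, because total
    mass and mean are both 1. The bound on all partial sums stands for Phi(y) <= u. *)
Lemma critical_gf_ge p y u : critical p -> 0 <= y ->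
  (forall n, \sum_(k < n) p k * y ^+ k <= u) -> y <= u.
Proof.
move=> [p0 _ _ cp cm] y0 H.
have : series p n + (y - 1) * series (fun k => k%:R * p k) n
    @[n --> \oo] --> 1 + (y - 1) * 1.
  by apply: cvgD => //; apply: cvgM => //; exact: cvg_cst.
rewrite (_ : 1 + (y - 1) * 1 = y); last by ring.
move=> /cvgr_to_le; apply.
apply: nearW => n; apply: le_trans (H n).
rewrite /series/= !big_mkord big_distrr -big_split/=; apply: ler_sum => k _.
by move: (ler_wpM2l (p0 k) (tangent_at1 k y0)); nra.
Qed.

(* The generating function of a critical law lies strictly above its tangent
   [y |-> y] at 1, except at 1. *)
Lemma critical_gf_fixpoint p y : critical p -> 0 <= y ->
  (forall n, \sum_(k < n) p k * y ^+ k <= y) -> y = 1.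
Proof.
move=> [p0 _ [k2 k2_ge2 pk2] cp cm] y0 H; apply/eqP/negPn/negP => y1.
(* The gap between the term [k2] and its tangent is present in every partial sum beyond [k2], so it
   survives in the limit. *)
set c := p k2 * (y ^+ k2 - (1 + k2%:R * (y - 1))).
have c0 : 0 < c by rewrite mulr_gt0// subr_gt0 tangent_at1_strict.
have : series p n + (y - 1) * series (fun k => k%:R * p k) n
    @[n --> \oo] --> 1 + (y - 1) * 1.
  by apply: cvgD => //; apply: cvgM => //; exact: cvg_cst.
rewrite (_ : 1 + (y - 1) * 1 = y); last by ring.
move=> lim_y.
suff step : \forall n \near \oo,
    series p n + (y - 1) * series (fun k => k%:R * p k) n <= y - c.
  have ync : y <= y - c by apply: cvgr_to_le lim_y step.
  by move: c0; rewrite ltNge -(gerDl y) -lerBrDr ync.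
near=> n; rewrite lerBrDr; apply: le_trans (H n).
have k2n : (k2 < n)%N by near: n; exact: nbhs_infty_gt.
rewrite /series/= !big_mkord big_distrr -big_split/=.
rewrite (bigD1 (Ordinal k2n))//= [leRHS](bigD1 (Ordinal k2n))//=.
have : \sum_(i < n | i != Ordinal k2n) (p i + (y - 1) * (i%:R * p i)) <=
       \sum_(i < n | i != Ordinal k2n) p i * y ^+ i.
  apply: ler_sum => k _.
  by move: (ler_wpM2l (p0 k) (tangent_at1 k y0)); nra.
by rewrite /c; lra.
Unshelve. all: by end_near.
Qed.

Lemma cvg_psum p (S : R^nat) y n : S @ \oo --> y ->
  \sum_(k < n) p k * S h ^+ k @[h --> \oo] --> \sum_(k < n) p k * y ^+ k.
Proof.
move=> Sy; elim: n => [|n IH].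
  by under eq_fun do rewrite big_ord0; rewrite big_ord0; exact: cvg_cst.
under eq_fun do rewrite big_ord_recr/=.
rewrite big_ord_recr/=; apply: cvgD => //; apply: cvgM; first exact: cvg_cst.
by apply: (@cvg_comp _ _ _ S (fun z : R => z ^+ n)) Sy _; exact: exprn_continuous.
Qed.

(** For a fixed truncation n, letting h tend to infinity in the recursion gives x Phi(y) <= y for
    the limit y, expressed through the partial sums of Phi. *)
Lemma iter_gf_bounded p x (S : R^nat) C : critical p -> 0 <= x ->
  (forall h, S h.+1 = x * \sum_(k < h.+1) p k * S h ^+ k) ->
  nondecreasing_seq S -> (forall h, 0 <= S h) -> (forall h, S h <= C) ->
  exists y, [/\ S @ \oo --> y, forall h, S h <= y &
                forall n, x * \sum_(k < n) p k * y ^+ k <= y].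
Proof.
move=> [p0 _ _ _ _] x0 SE ndS S0 SC.
have cS : cvgn S.
  by apply: nondecreasing_is_cvgn => //; exists C => _ [h _ <-]; exact: SC.
have Sy h : S h <= limn S by exact: nondecreasing_cvgn_le.
exists (limn S); split => // n.
have : x * \sum_(k < n) p k * S h ^+ k @[h --> \oo] -->
    x * \sum_(k < n) p k * limn S ^+ k.
  by apply: cvgM; [exact: cvg_cst|exact: cvg_psum].
move=> /cvgr_to_le; apply; near=> h; apply: le_trans (Sy h.+1).
have nh : (n <= h.+1)%N by near: h; exists n => // m /= /leqW.
rewrite SE ler_wpM2l//.
rewrite -(big_mkord xpredT (fun k => p k * S h ^+ k)).
rewrite -[leRHS](big_mkord xpredT (fun k => p k * S h ^+ k)).
rewrite [leRHS](big_cat_nat (n := n))//= lerDl.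
by apply: sumr_ge0 => k _; rewrite mulr_ge0// exprn_ge0.
Unshelve. all: by end_near.
Qed.

Lemma tweight_ge0 p T : (forall k, 0 <= p k) -> 0 <= tweight p T.
Proof. by move=> p0; apply: prodr_ge0. Qed.

Lemma sized_tweight_node p x ts :
  x ^+ tsize (Node ts) * tweight p (Node ts) =
  x * p (size ts) * \prod_(t <- ts) (x ^+ tsize t * tweight p t).
Proof.
rewrite tsize_node tweight_node exprS big_split/=.
rewrite -(big_morph (fun n => x ^+ n) (exprD x) (expr0 x)).
by ring.
Qed.

Definition box_gf p x h : R :=
  \sum_(T <- box h) x ^+ tsize T * tweight p T.

Lemma box_gfS p x h :
  box_gf p x h.+1 = x * \sum_(k < h.+1) p k * box_gf p x h ^+ k.
Proof.
rewrite /box_gf (@sum_boxS_mult _ _ (fun k => x * p k) _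
  (fun T => x ^+ tsize T * tweight p T)).
  by rewrite big_distrr/=; apply: eq_bigr => k _; rewrite mulrA.
by move=> ts; rewrite sized_tweight_node.
Qed.

Lemma sum_box_le (h h' : nat) (g : ptree -> R) : (h <= h')%N ->
  (forall T, 0 <= g T) -> \sum_(T <- box h) g T <= \sum_(T <- box h') g T.
Proof.
by move=> hh' g0; apply: big_subseq_le => //; [exact: box_uniq|exact: box_mono].
Qed.

Lemma box_gf_nd p x : (forall k, 0 <= p k) -> 0 <= x ->
  nondecreasing_seq (box_gf p x).
Proof.
move=> p0 x0 h h' hh'; apply: sum_box_le => // T.
by rewrite mulr_ge0 ?exprn_ge0 ?tweight_ge0.
Qed.

Lemma box_gf_ge0 p x h : (forall k, 0 <= p k) -> 0 <= x -> 0 <= box_gf p x h.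
Proof.
move=> p0 x0; apply: sumr_ge0 => T _.
by rewrite mulr_ge0 ?exprn_ge0 ?tweight_ge0.
Qed.

(** A bound would produce some y > 0 with x Phi(y) <= y, whereas Phi(y) >= y and x > 1. *)
Lemma box_gf_unbounded p x C : critical p -> 1 < x ->
  ~ (forall h, box_gf p x h <= C).
Proof.
move=> cp x1 HC; have x0 : 0 < x by rewrite (lt_trans _ x1).
have [p0 pp0 _ _ _] := cp.
have [y [_ Sy fy]] := iter_gf_bounded cp (ltW x0) (box_gfS p x)
  (box_gf_nd p0 (ltW x0)) (fun h => box_gf_ge0 h p0 (ltW x0)) HC.
have y0 : 0 < y.
  by apply: lt_le_trans (fy 1%N); rewrite big_ord1 expr0 mulr1 mulr_gt0.
have : y <= y / x.
  apply: (critical_gf_ge cp (ltW y0)) => n.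
  by rewrite ler_pdivlMr// mulrC.
by rewrite ler_pdivlMr// ger_pMr// leNgt x1.
Qed.

Definition box_mass p h : R := \sum_(T <- box h) tweight p T.

Lemma box_massE p h : box_mass p h = box_gf p 1 h.
Proof. by apply: eq_bigr => T _; rewrite expr1n mul1r. Qed.

Lemma box_mass_le1 p h : critical p -> box_mass p h <= 1.
Proof.
move=> cp; have [p0 _ _ _ _] := cp; rewrite box_massE.
elim: h => [|h IH]; first by rewrite /box_gf big_nil.
rewrite box_gfS mul1r; apply: le_trans (critical_psum_le1 h.+1 cp).
apply: ler_sum => k _; rewrite ler_piMr// exprn_ile1//.
exact: box_gf_ge0.
Qed.

(** A critical Galton-Watson tree is almost surely finite: the limit y of the masses satisfies
    Phi(y) <= y, which forces y = 1. *)
Lemma cvg_box_mass p : critical p -> box_mass p @ \oo --> (1 : R).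
Proof.
move=> cp; have [p0 pp0 _ _ _] := cp.
have -> : box_mass p = box_gf p 1 by apply/funext => h; rewrite box_massE.
have SC h : box_gf p 1 h <= 1 by rewrite -box_massE box_mass_le1.
have [y [cy Sy fy]] := iter_gf_bounded cp ler01 (box_gfS p 1)
  (box_gf_nd p0 ler01) (fun h => box_gf_ge0 h p0 ler01) SC.
have y0 : 0 <= y by apply: le_trans (Sy 0%N); exact: box_gf_ge0.
suff y1 : y = 1 by move: cy; rewrite y1.
by apply: (critical_gf_fixpoint cp y0) => n; rewrite -[leLHS]mul1r.
Qed.

(** * Mean width at a fixed height *)

Definition width_mass p h N : R :=
  \sum_(T <- box N) tweight p T * (width h T)%:R.

Lemma width_massS p h N : width_mass p h.+1 N.+1 =
  \sum_(k < N.+1) p k * (k%:R * box_mass p N ^+ k.-1 * width_mass p h N).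
Proof.
rewrite /width_mass sum_boxS; apply: eq_bigr => k _.
rewrite -sum_words_add big_distrr/= big_seq [RHS]big_seq.
apply: eq_bigr => f; rewrite mem_words => /andP[/eqP fk _].
by rewrite tweight_node fk widthS natr_sum mulrA.
Qed.

Lemma width_mass_ge0 p h N : (forall k, 0 <= p k) -> 0 <= width_mass p h N.
Proof.
by move=> p0; apply: sumr_ge0 => T _; rewrite mulr_ge0 ?tweight_ge0.
Qed.

(** A critical Galton-Watson tree has mean width 1 at every height, attained up to eps on a finite
    box. In the induction on h, the truncation of the mean offspring to k < K, the power of the box
    mass and the induction hypothesis each cost a factor 1 - e. *)
Lemma width_mass_ge p h (eps : R) : critical p -> 0 < eps ->
  exists N, 1 - eps <= width_mass p h N.
Proof.
move=> cp; have [p0 _ _ _ cm] := cp; elim: h eps => [|h IH] eps eps0.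
  have /cvgr_dist_le/(_ eps eps0)[N _ HN] := cvg_box_mass cp.
  exists N; rewrite (_ : width_mass p 0 N = box_mass p N); last first.
    by apply: eq_bigr => T _; rewrite width0 mulr1.
  have := HN N (leqnn _); rewrite /= ger0_norm ?subr_ge0 ?box_mass_le1//.
  lra.
wlog eps1 : eps eps0 / eps <= 1.
  move=> W; have [e1|e1] := leP eps 1; first exact: W.
  have [N HN] := W 1 ltr01 (lexx _); exists N; lra.
(* The three factors are compatible with eps since (1 - e)^3 >= 1 - 3e. *)
set e := eps / 3; have e0 : 0 < e by rewrite /e; lra.
have /cvgr_dist_le/(_ e e0)[K _ HK] := cm.
have {HK} HK : 1 - e <= \sum_(k < K) k%:R * p k.
  have := HK K (leqnn _); rewrite /= /series/= big_mkord.
  by move=> /(le_trans (ler_norm _)); lra.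
have [N1 HN1] := IH _ e0.
(* By Bernoulli's inequality the K-th power of the mass has at most K times its defect, so a defect
   below e / (K + 1) suffices. *)
have e'0 : 0 < e / K.+1%:R by rewrite divr_gt0.
have /cvgr_dist_le/(_ _ e'0)[N2 _ HN2] := cvg_box_mass cp.
set N := maxn K (maxn N1 N2).
have S0 : 0 <= box_mass p N by rewrite box_massE box_gf_ge0.
have S1 : box_mass p N <= 1 by exact: box_mass_le1.
have S2 : 1 - e <= box_mass p N ^+ K.
  have := HN2 N; rewrite /= ger0_norm ?subr_ge0// => /(_ _) H.
  have {}H : 1 - box_mass p N <= e / K.+1%:R by apply: H; rewrite /N !leq_max leqnn !orbT.
  apply: le_trans (tangent_at1 K S0).
  have : K%:R * (1 - box_mass p N) <= e.
    apply: (@le_trans _ _ (K.+1%:R * (e / K.+1%:R))); last by rewrite mulrC divfK.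
    by apply: ler_pM => //; rewrite ?subr_ge0// ler_nat.
  lra.
have M2 : 1 - e <= width_mass p h N.
  apply: le_trans HN1 _; apply: sum_box_le; first by rewrite /N !leq_max leqnn orbT.
  by move=> T; rewrite mulr_ge0 ?tweight_ge0.
exists N.+1; rewrite width_massS.
apply: (@le_trans _ _ ((\sum_(k < K) k%:R * p k) * (box_mass p N ^+ K * width_mass p h N))).
  have e1 : 0 <= 1 - e by rewrite /e; lra.
  apply: (@le_trans _ _ ((1 - e) * ((1 - e) * (1 - e)))); last first.
    by apply: ler_pM => //; [exact: mulr_ge0|apply: ler_pM].
  have -> : eps = 3 * e by rewrite /e; lra.
  by have := sqr_ge0 e; nra.
rewrite big_distrl/=.
pose F k := k%:R * p k * (box_mass p N ^+ K * width_mass p h N).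
pose G k := p k * (k%:R * box_mass p N ^+ k.-1 * width_mass p h N).
rewrite -(big_mkord xpredT F) -(big_mkord xpredT G).
have G0 k : 0 <= G k.
  by rewrite /G !mulr_ge0// ?exprn_ge0// width_mass_ge0.
rewrite [leRHS](big_cat_nat (n := K))//=; last by rewrite /N leqW// leq_max leqnn.
rewrite -[leLHS]addr0 lerD//; last by apply: sumr_ge0.
rewrite big_nat [leRHS]big_nat; apply: ler_sum => k /andP[_ kK].
rewrite /F /G; have -> : p k * (k%:R * box_mass p N ^+ k.-1 * width_mass p h N) =
  k%:R * p k * (box_mass p N ^+ k.-1 * width_mass p h N) by ring.
apply: ler_wpM2l; first by rewrite mulr_ge0.
apply: ler_wpM2r; first exact: width_mass_ge0.
by apply: ler_wiXn2l => //; lia.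
Qed.

End Critical.

(** * Numerical semigroups *)

(** The least positive difference e of two elements of [S] divides every generator, hence d. So [S]
    contains two consecutive multiples dv and dv + d, and dividing q by v writes every qd with q >=
    v^2 as a combination of these two. *)
Lemma semigroup_eventually (S G : nat -> Prop) (d : nat) :
  (forall i, G i -> S i) -> S 0%N -> (forall i j, S i -> S j -> S (i + j)%N) ->
  (exists2 i, (0 < i)%N & G i) ->
  (forall d', (forall i, G i -> (d' %| i)%N) -> (d' %| d)%N) ->
  exists m, forall k, (m <= k)%N -> (d %| k)%N -> S k.
Proof.
move=> GS S0 SD [i0 i0_gt0 Gi0] gcdG.
have SM i n : S i -> S (n * i)%N.
  by move=> Si; elim: n => [//|n IH]; rewrite mulSn; exact: SD.
pose diff e := `[< (0 < e)%N /\ exists2 y, S y & S (y + e)%N >].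
have ex_e : exists e, diff e.
  by exists i0; apply/asboolP; split=> //; exists 0%N => //; rewrite add0n; exact: GS.
case: (ex_minnP ex_e) => e /asboolP[e0 [y Sy Sye]] mine.
have eG i : G i -> (e %| i)%N.
  move=> /GS Si; rewrite /dvdn; case: posnP => // r0.
  (* A nonzero remainder r would be a smaller difference: if i = a e + r, then a (y + e) and a (y +
     e) + r = i + a y both lie in [S]. *)
  suff /mine : diff (i %% e)%N by rewrite leqNgt ltn_mod e0.
  apply/asboolP; split=> //; exists (i %/ e * (y + e))%N; first exact: SM.
  have -> : (i %/ e * (y + e) + i %% e = i + i %/ e * y)%N.
    by rewrite mulnDr {4}(divn_eq i e); ring.
  exact: SD Si (SM _ _ Sy).
have /dvdnP[t dE] := gcdG e eG.
(* A multiple [d * (t * y)] of d such that its successor multiple is in S. *)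
set v := (t * y)%N.
have SV : S (d * v)%N by rewrite /v mulnA; exact: SM.
have SU : S (d * v + d)%N.
  have [d0|d_gt0] := posnP d; first by rewrite d0 mul0n.
  have -> : (d * v + d = t * (y + e) + (d.-1 * t) * y)%N.
    by rewrite mulnDr -dE /v -{1}(prednK d_gt0); nia.
  exact: SD (SM _ _ Sye) (SM _ _ Sy).
exists (d * (v * v))%N => k mk /dvdnP[q qE].
have [d0|d_gt0] := posnP d; first by rewrite qE d0 muln0.
have [v0|v_gt0] := posnP v.
  by move: SU; rewrite v0 muln0 add0n qE => /(SM _ q).
have rv : (q %% v < v)%N by rewrite ltn_mod.
have vq : (v <= q %/ v)%N by rewrite leq_divRL//; nia.
have -> : k = (q %% v * (d * v + d) + (q %/ v - q %% v) * (d * v))%N.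
  have := divn_eq q v; set a := (q %/ v)%N in vq *; set r := (q %% v)%N in rv *.
  move=> qv; have [u au] : exists u, a = (u + r)%N by exists (a - r)%N; lia.
  by rewrite qE qv au addnK; ring.
exact: SD (SM _ _ SU) (SM _ _ SV).
Qed.

(** * Growth of the partition function *)

Section PartitionFunction.
Variable R : realType.
Implicit Types (p c : nat -> R).

Definition zn p n : R := \sum_(T <- trees_of_size n) tweight p T.

(** The weight [c] of the number of trees is kept apart from [p] because splitting off the first
    tree shifts it by one. *)
Definition forest_sum p c n : R :=
  \sum_(f <- forests n n) c (size f) * \prod_(t <- f) tweight p t.

Lemma zn_forest p n : zn p n.+1 = forest_sum p p n.
Proof. by rewrite /zn big_map; apply: eq_bigr => f _; rewrite tweight_node. Qed.

Lemma forests_fuel fuel n : (n <= fuel)%N ->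
  perm_eq (forests fuel n) (forests n n).
Proof.
move=> nf; apply: uniq_perm; [exact: forests_uniq|exact: forests_uniq|].
by move=> f; rewrite !mem_forests.
Qed.

Lemma forest_sumS p c n : forest_sum p c n.+1 =
  \sum_(0 <= k < n.+1) zn p k.+1 * forest_sum p (fun i => c i.+1) (n - k).
Proof.
rewrite {1}/forest_sum forestsS big_flatten big_map.
rewrite -[iota 0 n.+1]/(index_iota 0 n.+1) !big_nat.
apply: eq_bigr => k /andP[_ kn]; rewrite big_allpairs_dep/= subSS.
rewrite zn_forest {1}/forest_sum big_distrl/=.
rewrite (perm_big _ (@forests_fuel n k _))//=; apply: eq_bigr => f _.
rewrite (perm_big _ (@forests_fuel n (n - k) _)) ?leq_subr//= big_distrr/=.
by apply: eq_bigr => g _; rewrite big_cons tweight_node; ring.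
Qed.

Lemma forest_sum_ge0 p c n : (forall k, 0 <= p k) -> (forall k, 0 <= c k) ->
  0 <= forest_sum p c n.
Proof.
move=> p0 c0; apply: sumr_ge0 => f _; rewrite mulr_ge0//.
by apply: prodr_ge0 => t _; exact: tweight_ge0.
Qed.

Lemma zn_ge0 p n : (forall k, 0 <= p k) -> 0 <= zn p n.
Proof. by move=> p0; apply: sumr_ge0 => T _; exact: tweight_ge0. Qed.

Lemma zn1 p : zn p 1 = p 0%N.
Proof. by rewrite zn_forest /forest_sum /= big_seq1 big_nil mulr1. Qed.

(** Analytic form of grafting a tree with m + 1 vertices onto the leftmost leaf of the forest: the
    leaf's weight [p 0] is lost, and it is at most 1. The induction descends into the first tree,
    whose children form a forest weighted by [c = p]. *)
Lemma forest_sum_supermult p c n m : (forall k, 0 <= p k) -> p 0%N <= 1 ->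
  (forall k, 0 <= c k) ->
  zn p m.+1 * forest_sum p c n.+1 <= forest_sum p c (n.+1 + m).
Proof.
move=> p0 p1; elim/ltn_ind: n c => n IH c c0.
have zD k : (k <= n)%N -> zn p m.+1 * zn p k.+1 <= zn p (k + m).+1.
  case: k => [|k] kn; first by rewrite zn1 add0n ler_piMr// zn_ge0.
  by rewrite !zn_forest -zn_forest; exact: IH.
rewrite addSn !forest_sumS.
(* On the right only the terms whose first tree has more than m vertices are kept. *)
rewrite [leRHS](big_cat_nat (n := m))//=; last by rewrite ltnW// ltnS leq_addl.
apply: (@le_trans _ _ (\sum_(m <= k < (n + m).+1)
   zn p k.+1 * forest_sum p (fun i => c i.+1) (n + m - k))); last first.
  rewrite lerDr; apply: sumr_ge0 => k _.
  by rewrite mulr_ge0 ?zn_ge0 ?forest_sum_ge0.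
rewrite -{2}[m]add0n big_addn -addSn addnK big_distrr/= big_nat [leRHS]big_nat.
apply: ler_sum => k /andP[_ kn].
by rewrite subnDr mulrA ler_wpM2r ?forest_sum_ge0// zD.
Qed.

Lemma zn_supermult p j k : (forall k, 0 <= p k) -> p 0%N <= 1 ->
  zn p j.+1 * zn p k.+1 <= zn p (j + k).+1.
Proof.
move=> p0 p1; case: k => [|k].
  by rewrite zn1 addn0 ler_piMr// zn_ge0.
rewrite [zn p k.+2]zn_forest [zn p (_ + _).+1]zn_forest addnC.
exact: forest_sum_supermult.
Qed.

Lemma critical_le1 p k : critical p -> p k <= 1.
Proof.
move=> cp; apply: le_trans (critical_psum_le1 k.+1 cp).
have [p0 _ _ _ _] := cp.
by rewrite big_ord_recr/= lerDr; apply: sumr_ge0.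
Qed.

Lemma zn_gt0_star p k : critical p -> 0 < p k -> 0 < zn p k.+1.
Proof.
move=> cp pk; have [p0 pp0 _ _ _] := cp.
pose star := Node (nseq k (Node [::])).
have starE : tweight p star = p k * p 0%N ^+ k.
  rewrite tweight_node size_nseq; congr (_ * _).
  rewrite big_seq (eq_bigr (fun=> p 0%N)) => [|t /nseqP[-> _]]; last first.
    by rewrite tweight_node big_nil mulr1.
  rewrite -big_seq big_const_seq count_predT size_nseq.
  by rewrite -[RHS]mulr1 -iter_mulr.
have starin : star \in trees_of_size k.+1.
  rewrite mem_trees_of_size tsize_node eqSS.
  rewrite big_seq (eq_bigr (fun=> 1%N)) => [|t /nseqP[-> _]//].
  by rewrite -big_seq sum1_size size_nseq.
rewrite /zn (bigD1_seq star) ?trees_of_size_uniq//= starE.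
apply: ltr_wpDr; last by rewrite mulr_gt0 ?exprn_gt0.
by apply: sumr_ge0 => T _; exact: tweight_ge0.
Qed.

Lemma sum_box_trees_of_size h (g : ptree -> R) : (forall T, 0 <= g T) ->
  exists N, \sum_(T <- box h) g T <=
    \sum_(0 <= n < N) \sum_(T <- trees_of_size n) g T.
Proof.
move=> g0; exists (\max_(T <- box h) tsize T).+1.
rewrite /index_iota subn0 -(big_map trees_of_size xpredT
  (fun s => \sum_(T <- s) g T)) -big_flatten.
apply: big_subseq_le => //; first exact: box_uniq.
move=> T Tb; apply/flatten_mapP; exists (tsize T).
  by rewrite mem_iota add0n ltnS /=; apply: (@leq_bigmax_seq _ _ _ tsize).
by rewrite mem_trees_of_size.
Qed.

Lemma geometric_sum_le (x : R) N : 0 <= x < 1 ->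
  \sum_(0 <= n < N) x ^+ n <= (1 - x)^-1.
Proof.
move=> /andP[x0 x1]; have x1' : 0 < 1 - x by rewrite subr_gt0.
rewrite -[leRHS]mul1r ler_pdivlMr// big_mkord mulrC.
have := subrX1 x N; have := exprn_ge0 N x0; lra.
Qed.

(** Otherwise Z_n < e^(-delta n) for all n >= 2, and the generating function at x = e^(delta / 2) >
    1 would be dominated by a geometric series, contradicting [box_gf_unbounded]. *)
Lemma zn_ge_exp_frequently p (delta : R) : critical p -> 0 < delta ->
  exists2 k, (0 < k)%N & expR (- (delta * k.+1%:R)) <= zn p k.+1.
Proof.
move=> cp d0; have [p0 _ _ _ _] := cp; apply/not_exists2P => H.
have zlt n : (2 <= n)%N -> zn p n < expR (- delta) ^+ n.
  case: n => [//|[//|n]] _; have [//|] := H n.+1.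
  by rewrite -expRM_natr mulNr ltNge => /negP.
set x := expR (delta / 2); set y := expR (- (delta / 2)).
have xy n : x ^+ n * expR (- delta) ^+ n = y ^+ n.
  by rewrite -exprMn -expRD; congr (expR _ ^+ n); lra.
have y01 : 0 <= y < 1 by rewrite expR_ge0 expR_lt1; lra.
have x1 : 1 < x by rewrite expR_gt1; lra.
(* The assumption concerns n >= 2, so the single-vertex tree contributes the separate term
   [x * p 0]. *)
apply: (@box_gf_unbounded _ p x (x * p 0%N + (1 - y)^-1) cp x1) => h.
have [|N HN] := @sum_box_trees_of_size h (fun T => x ^+ tsize T * tweight p T).
  by move=> T; rewrite mulr_ge0 ?exprn_ge0 ?expR_ge0 ?tweight_ge0.
apply: le_trans HN _.
apply: (@le_trans _ _ (\sum_(0 <= n < N) ((n == 1%N)%:R * (x * p 0%N) + y ^+ n))).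
  apply: ler_sum => n _.
  have -> : \sum_(T <- trees_of_size n) x ^+ tsize T * tweight p T = x ^+ n * zn p n.
    rewrite big_distrr/= big_seq [RHS]big_seq; apply: eq_bigr => T.
    by rewrite mem_trees_of_size => /eqP ->.
  case: n => [|[|n]].
  - by rewrite /zn big_nil mulr0 mul0r add0r expr0.
  - by rewrite zn1 !expr1 eqxx mul1r lerDl expR_ge0.
  - rewrite mul0r add0r -xy ler_wpM2l ?exprn_ge0 ?expR_ge0//.
    exact/ltW/zlt.
rewrite big_split/= lerD ?geometric_sum_le// -big_distrl/=.
rewrite ler_piMl ?mulr_ge0 ?expR_ge0//.
rewrite -natr_sum big_mkord (_ : 1 = 1%:R)// ler_nat.
have [N1|N1] := ltnP 1 N.
  by rewrite (bigD1 (Ordinal N1))//= big1// => i; rewrite -val_eqE/= => /negPf ->.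
by rewrite big1// => i _; apply/eqP; rewrite eqb0; apply/negP => /eqP iE;
  have := ltn_ord i; rewrite iE; lia.
Qed.

Lemma seq_pos_lower_bound (s : seq nat) (b : nat -> R) :
  exists2 c, 0 < c & forall i, i \in s -> 0 < b i -> c <= b i.
Proof.
elim: s => [|i s [c c0 IH]]; first by exists 1.
have [bi|bi] := ltP 0 (b i).
  exists (Order.min c (b i)); first by rewrite lt_min c0.
  move=> j; rewrite inE ge_min => /predU1P[->|js] bj; first by rewrite lexx orbT.
  by rewrite IH.
exists c => // j; rewrite inE => /predU1P[->|]; last exact: IH.
by rewrite ltNge bi.
Qed.

(** With a_j = Z_(j+1), supermultiplicativity reads a_j a_k <= a_(j+k). One good index k yields a
    good multiple [k1] of d; subtracting [k1] repeatedly brings any large multiple of d into a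
    finite window, on which the positive values are bounded below by a constant [c]. *)
Lemma zn_subexp p d (delta : R) : critical p -> is_span p d -> 0 < delta ->
  exists N, forall n, (N <= n)%N -> n = 1%N %[mod d] ->
    expR (- (delta * n%:R)) <= zn p n.
Proof.
move=> cp [dvdp gcdp] d0; have [p0 pp0 [k2 k2_ge2 pk2] _ _] := cp.
have p01 := critical_le1 0 cp.
have sm j k := @zn_supermult p j k p0 p01.
have zM j n : zn p j.+1 ^+ n.+1 <= zn p (n.+1 * j).+1.
  elim: n => [|n IH]; first by rewrite mul1n.
  rewrite exprS mulSn; apply: le_trans (sm _ _).
  by rewrite ler_wpM2l// zn_ge0.
have [m Hm] : exists m, forall k, (m <= k)%N -> (d %| k)%N -> 0 < zn p k.+1.
  apply: (@semigroup_eventually _ (fun i => 0 < p i)) => //.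
  - by move=> i; exact: zn_gt0_star.
  - by rewrite zn1.
  - by move=> i j zi zj; apply: lt_le_trans (sm _ _); exact: mulr_gt0.
  - by exists k2 => //; lia.
have d_gt0 : (0 < d)%N by apply: dvdn_gt0 (dvdp _ pk2); lia.
(* Since k + 1 <= 2k, the rate delta / 4 per vertex costs at most delta / 2 per unit of k, which is
   the rate of [y]. The other half of delta absorbs [c]. *)
set q := delta / 4; have q0 : 0 < q by rewrite /q; lra.
have [k k_gt0 Hk] := zn_ge_exp_frequently cp q0.
set y := expR (- (delta / 2)).
have y0 : 0 < y by exact: expR_gt0.
have y1 : y <= 1 by rewrite expR_le1; lra.
set k1 := (d * k)%N.
have k1_gt0 : (0 < k1)%N by rewrite muln_gt0 d_gt0.
have Hk1 : y ^+ k1 <= zn p k1.+1.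
  rewrite /k1 -(prednK d_gt0); apply: le_trans (zM _ _).
  rewrite [(_ * k)%N]mulnC exprM; apply: lerXn2r; rewrite ?nnegrE ?exprn_ge0 ?zn_ge0 ?(ltW y0)//.
  apply: le_trans Hk; rewrite /y -expRM_natr ler_expR mulNr lerN2 /q.
  have : k.+1%:R <= 2 * k%:R :> R by rewrite -natrM ler_nat; lia.
  nra.
have [c c0 Hc] := seq_pos_lower_bound (iota m k1) (fun k => zn p k.+1).
have low j : (m <= j)%N -> (d %| j)%N -> c * y ^+ j <= zn p j.+1.
  elim/ltn_ind: j => j IH mj dj.
  have [jk|jk] := ltnP j (m + k1)%N.
    apply: (@le_trans _ _ c); first by rewrite ler_piMr ?(ltW c0)// exprn_ile1// ltW.
    by apply: Hc; [rewrite mem_iota mj|exact: Hm].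
  have -> : j = (k1 + (j - k1))%N by lia.
  apply: le_trans (sm _ _); rewrite exprD mulrCA.
  apply: ler_pM; rewrite ?mulr_ge0 ?exprn_ge0 ?(ltW y0) ?(ltW c0)//.
  apply: IH; [lia|lia|].
  by rewrite dvdn_subr// ?dvdn_mulr//; lia.
have [N _ HN] : \forall n \near \oo, y ^+ n <= c.
  have : (y ^+ n : R) @[n --> \oo] --> (0 : R).
    by apply: cvg_expr; rewrite ger0_norm ?(ltW y0)// expR_lt1; lra.
  by move=> /cvgr_le; apply.
exists (maxn N m.+1) => -[|n]; first by move=> ?; exfalso; lia.
rewrite geq_max => /andP[Nn mn] nd.
have dn : (d %| n)%N by apply/eqP; move/eqP: nd; rewrite -[n.+1]addn1 -{2}[1%N]add0n eqn_modDr mod0n => /eqP.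
apply: le_trans (low _ mn dn).
have -> : expR (- (delta * n.+1%:R)) = y ^+ n.+1 * y ^+ n.+1.
  by rewrite -exprMn -expRD -expRM_natr; congr expR; rewrite -mulNr; congr (_ * _); lra.
apply: ler_pM; rewrite ?exprn_ge0 ?(ltW y0)//; first exact: HN.
by apply: ler_wiXn2l => //; exact: ltW.
Qed.

End PartitionFunction.

(** * Fringe subtrees *)

Section Fringe.
Variable R : realType.
Implicit Types (p : nat -> R) (x z : R).

Section CopiesGeneratingFunction.
Variables (p : nat -> R) (x z : R) (tau : ptree).

Definition copies_gf_term (T : ptree) : R :=
  z ^+ tsize T * (tweight p T * x ^+ ncopies tau T).

(** Only the copies of tau strictly below the root are weighted here. This makes the product
    recursion exact, and the difference from [copies_gf_term] is confined to the tree tau itself. *)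
Let proper_term (T : ptree) : R :=
  z * p (size (children T)) * \prod_(t <- children T) copies_gf_term t.

Lemma copies_gf_termE T : copies_gf_term T = proper_term T * x ^+ (T == tau).
Proof.
case: T => ts; rewrite /copies_gf_term /proper_term/=.
rewrite tsize_node tweight_node ncopies_node exprS exprD !big_split/=.
rewrite -(big_morph (fun n => z ^+ n) (exprD z) (expr0 z)).
rewrite -(big_morph (fun n => x ^+ n) (exprD x) (expr0 x)).
by ring.
Qed.

(** By size, tau has no copy of itself strictly below its root, so no factor [x] appears. *)
Lemma proper_term_tau : proper_term tau = z ^+ tsize tau * tweight p tau.
Proof.
rewrite /proper_term; case E : tau => [ts]/=.
rewrite sized_tweight_node big_seq [in RHS]big_seq; congr (_ * _).
apply: eq_bigr => t tts; rewrite /copies_gf_term ncopies_small ?mulr1//.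
by rewrite E tsize_child.
Qed.

(* The constant 1 is a supersolution of the equation
   [Y = z Phi(Y) - (1 - x) z^|tau| p(tau)] satisfied by the generating function
   of trees in which every copy of tau is weighted by x.  The last hypothesis
   takes care of the stages of the iteration that do not yet contain tau. *)
Lemma copies_gf_le1 h : critical p -> 0 <= x <= 1 -> 1 <= z ->
  z <= 1 + (1 - x) * tweight p tau ->
  z ^+ (\max_(T <- box (tsize tau)) tsize T) * (1 - tweight p tau) <= 1 ->
  \sum_(T <- box h) copies_gf_term T <= 1.
Proof.
move=> cp /andP[x0 x1] z1 zx zM; have [p0 _ _ _ _] := cp.
have z0 : 0 <= z by rewrite (le_trans _ z1).
have G0 T : 0 <= copies_gf_term T.
  by rewrite !mulr_ge0 ?exprn_ge0 ?tweight_ge0.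
elim: h => [|h IH]; first by rewrite big_nil.
have [tb|tb] := boolP (tau \in box h.+1).
  have -> : \sum_(T <- box h.+1) copies_gf_term T =
      \sum_(T <- box h.+1) proper_term T - (1 - x) * proper_term tau.
    rewrite (bigD1_seq tau) ?box_uniq//= [X in _ = X - _](bigD1_seq tau) ?box_uniq//=.
    rewrite copies_gf_termE eqxx expr1.
    rewrite (eq_bigr proper_term) => [|T /negPf nT]; first by ring.
    by rewrite copies_gf_termE nT mulr1.
  rewrite (@sum_boxS_mult _ _ (fun k => z * p k) proper_term copies_gf_term)//.
  rewrite proper_term_tau.
  apply: (@le_trans _ _ (z - (1 - x) * tweight p tau)); last by lra.
  rewrite lerB//.
    rewrite -[leRHS]mulr1; under eq_bigr do rewrite -mulrA.
    rewrite -big_distrr/= ler_wpM2l//; apply: le_trans (critical_psum_le1 h.+1 cp).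
    apply: ler_sum => k _; rewrite ler_piMr// exprn_ile1//.
    exact: sumr_ge0.
  rewrite ler_wpM2l ?subr_ge0//; apply: ler_peMl; first exact: tweight_ge0.
  exact: exprn_ege1.
(* As long as tau is missing, the stage lies inside [box (tsize tau)], so its mass is at most 1 -
   p(tau); this compensates for the powers of [z]. *)
have sb : {subset box h.+1 <= box (tsize tau)}.
  apply: box_mono; rewrite leqNgt; apply/negP => tle.
  by move: tb; rewrite (@box_mono (tsize tau) h.+1 (ltnW tle))// mem_box.
have mass : tweight p tau + box_mass p h.+1 <= 1.
  apply: le_trans (box_mass_le1 (tsize tau) cp).
  rewrite -(big_cons _ _ tau _ xpredT (tweight p)); apply: big_subseq_le.
  - by rewrite cons_uniq tb box_uniq.
  - by move=> T; rewrite inE => /predU1P[->|]; [exact: mem_box|exact: sb].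
  - by move=> T; exact: tweight_ge0.
apply: le_trans zM; set M := \max_(T <- _) _.
apply: (@le_trans _ _ (z ^+ M * box_mass p h.+1)); last first.
  by rewrite ler_wpM2l ?exprn_ge0//; lra.
rewrite big_distrr/= big_seq [leRHS]big_seq; apply: ler_sum => T Tb.
apply: ler_pM; rewrite ?mulr_ge0 ?exprn_ge0 ?tweight_ge0//.
  apply: ler_weXn2l => //.
  exact: (@leq_bigmax_seq _ _ _ tsize _ (sb _ Tb)).
by rewrite ler_piMr ?tweight_ge0// exprn_ile1.
Qed.

End CopiesGeneratingFunction.

(** With x = e^(-th) and z = e^(th (q - e)), [copies_gf_le1] bounds by 1 the sum over trees T of
    size n of p(T) exp(th (q - e) n - th N(T)), where N counts the copies of tau. Multiplying by
    e^(-L) <= Z_n and linearising the exponential gives an inequality that is solved for the sum of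
    p(T) N(T). *)
Lemma ncopies_mean_ge p d tau (eps : R) : critical p -> is_span p d ->
  0 < eps -> exists N, forall n, (N <= n)%N -> n = 1%N %[mod d] ->
    (tweight p tau - eps) * n%:R * zn p n <=
    \sum_(T <- trees_of_size n) tweight p T * (ncopies tau T)%:R.
Proof.
move=> cp sp eps0; have [p0 _ _ _ _] := cp.
set q := tweight p tau.
have q0 : 0 <= q by exact: tweight_ge0.
have q1 : q <= 1.
  apply: le_trans (box_mass_le1 (tsize tau) cp).
  rewrite /box_mass (bigD1_seq tau) ?box_uniq ?mem_box//= lerDl.
  by apply: sumr_ge0 => T _; exact: tweight_ge0.
have [qe|qe] := leP q eps.
  exists 0%N => n _ _; apply: (@le_trans _ _ 0).
    by rewrite -mulrA mulr_le0_ge0 ?subr_le0// mulr_ge0 ?zn_ge0.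
  by apply: sumr_ge0 => T _; rewrite mulr_ge0 ?tweight_ge0.
(* Half of eps is given up in the growth rate of [z], the other half pays for the subexponential
   factor e^(-L). *)
have [e e0 epsE] : exists2 e, 0 < e & eps = e + e by exists (eps / 2); lra.
have qe0 : 0 < q - e by lra.
set M := (\max_(T <- box (tsize tau)) tsize T)%N.
(* The bound th <= e / 2 controls the second-order terms in [zx], and th M <= 1 yields [zM]. *)
have [th th0 [the thM]] : exists2 th, 0 < th & th <= e / 2 /\ th * M%:R <= 1.
  exists (Order.min (e / 2) (M.+1%:R^-1)).
    by rewrite lt_min invr_gt0 ltr0Sn andbT; lra.
  split; first by rewrite ge_min lexx.
  apply: (@le_trans _ _ (M.+1%:R^-1 * M.+1%:R)); last by rewrite mulVf.
  apply: ler_pM; [|exact: ler0n| |by rewrite ler_nat].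
    by rewrite le_min invr_ge0 ler0n andbT; lra.
  by rewrite ge_min lexx orbT.
have expR_le (u : R) : expR u * (1 - u) <= 1.
  rewrite -[leRHS](_ : expR u * expR (- u) = 1); last by rewrite -expRD subrr expR0.
  by rewrite ler_pM2l ?expR_gt0// expR_ge1Dx.
set x := expR (- th); set z := expR (th * (q - e)).
have x0 : 0 < x by exact: expR_gt0.
have x1 : x <= 1 by rewrite expR_le1; lra.
have z0 : 0 < z by exact: expR_gt0.
have z1 : 1 <= z by rewrite -expR0 ler_expR mulr_ge0// ltW.
have xth : x * (1 + th) <= 1 by have := expR_le (- th); rewrite opprK.
have zth : z * (1 - th * (q - e)) <= 1 by exact: expR_le.
have zx : z <= 1 + (1 - x) * q.
  have e1 : e <= 1 by lra.
  have th1 : 0 < 1 - th * (q - e) by nra.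
  rewrite -(ler_pM2r th1); apply: le_trans zth _.
  have a : th / (1 + th) <= 1 - x.
    rewrite ler_pdivrMr; last by lra.
    lra.
  apply: (@le_trans _ _ ((1 + th / (1 + th) * q) * (1 - th * (q - e)))); last first.
    by rewrite ler_pM2r// lerD2l ler_wpM2r.
  (* After clearing denominators the claim is th (q - e) (1 + q) <= e, which follows from (q - e) (1
     + q) <= 2. *)
  rewrite -(@ler_pM2r _ (1 + th)); last by lra.
  have -> : (1 + th / (1 + th) * q) * (1 - th * (q - e)) * (1 + th) =
    (1 + th + th * q) * (1 - th * (q - e)) by field; lra.
  have b : (q - e) * (1 + q) <= 2.
    by rewrite -[leRHS]mul1r; apply: ler_pM; lra.
  have := ler_wpM2l (ltW th0) (ler_wpM2l (ltW th0) b).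
  have := ler_wpM2l (ltW th0) the; lra.
have zM : z ^+ M * (1 - q) <= 1.
  apply: le_trans (expR_le (th * (q - e) * M%:R)).
  rewrite -expRM_natr ler_pM2l ?expR_gt0// lerD2l lerN2.
  by rewrite mulrAC; nra.
have bound n : \sum_(T <- trees_of_size n) copies_gf_term p x z tau T <= 1.
  apply: le_trans (@copies_gf_le1 p x z tau n cp _ z1 zx zM); last by rewrite ltW.
  apply: big_subseq_le; first exact: trees_of_size_uniq.
    by move=> T; rewrite mem_trees_of_size => /eqP <-; exact: mem_box.
  by move=> T; rewrite !mulr_ge0 ?exprn_ge0 ?tweight_ge0// ltW.
have [N HN] := zn_subexp cp sp (mulr_gt0 e0 th0).
exists N => n Nn nd; have {HN}Hz := HN n Nn nd.
set L := e * th * n%:R in Hz.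
set EN := \sum_(T <- _) _.
(* The inequality e^u >= 1 + u plays the role of Jensen's inequality. *)
have : \sum_(T <- trees_of_size n) tweight p T *
    (1 + (th * (q - e) * n%:R - th * (ncopies tau T)%:R - L)) <= zn p n.
  apply: le_trans Hz.
  rewrite -[leRHS]mulr1; apply: le_trans (_ : _ <= expR (- L) * _) _; last first.
    rewrite ler_pM2l ?expR_gt0//; exact: (bound n).
  rewrite big_distrr/= big_seq [leRHS]big_seq; apply: ler_sum => T.
  rewrite mem_trees_of_size => /eqP Tn.
  rewrite /copies_gf_term Tn (_ : _ * (_ * (_ * _)) =
    tweight p T * (expR (- L) * z ^+ n * x ^+ ncopies tau T)); last by ring.
  rewrite ler_wpM2l ?tweight_ge0// -!expRM_natr -!expRD.
  apply: le_trans (expR_ge1Dx _) _; rewrite ler_expR.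
  by rewrite mulNr; lra.
rewrite (_ : \sum_(T <- _) _ = zn p n * (1 + (th * (q - e) * n%:R - L)) - th * EN); last first.
  rewrite /zn /EN big_distrl big_distrr/= -sumrB; apply: eq_bigr => T _; ring.
move=> H; have {H} : th * ((q - e) * n%:R * zn p n - EN) <= th * (e * n%:R * zn p n).
  by move: H; rewrite /L; nra.
rewrite ler_pM2l// => H; move: H; rewrite (_ : q - eps = q - e - e); last by rewrite epsE; ring.
by rewrite !mulrBl; lra.
Qed.

End Fringe.

(** * Extended fringe subtrees *)

(** The vertex [RC i] hangs off u_(i+1), so i < h says that it descends from u_h. *)
Definition below (h : nat) (x : nsv) : bool :=
  if x is RC i _ _ _ then (i < h)%N else true.

(* [agree h c c'] : c and c' coincide on the fringe subtree of u_h. *)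
Definition agree (h : nat) (c c' : conf) : Prop :=
  (forall i, (i < h)%N -> sdeg c i = sdeg c' i) /\
  (forall x, below h x -> odeg c x = odeg c' x).

Lemma agree_sym h c c' : agree h c c' -> agree h c' c.
Proof. by move=> [s o]; split=> [i /s|x /o]. Qed.

Lemma agree_trans h c c' c'' : agree h c c' -> agree h c' c'' -> agree h c c''.
Proof.
move=> [s o] [s' o']; split=> [i ih|x xh]; first by rewrite s// s'.
by rewrite o// o'.
Qed.

(** Everything below u_h, with h = |a|, is read off from the fringe subtree at b; this turns counts
    of fringe copies into information on pointed trees. *)
Lemma agree_pointed_conf T b a :
  agree (size a) (pointed_conf T (b ++ a)) (pointed_conf (subtree b T) a).
Proof.
have pos i : (i < size a)%N ->
    [/\ (i < size (b ++ a))%N,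
     take (size (b ++ a) - i.+1) (b ++ a) = b ++ take (size a - i.+1) a &
     nth 0%N (b ++ a) (size (b ++ a) - i.+1) = nth 0%N a (size a - i.+1)].
  move=> ia; rewrite size_cat.
  have -> : (size b + size a - i.+1 = size b + (size a - i.+1))%N by lia.
  split; first by lia.
    by rewrite take_cat ltnNge leq_addr/= addKn.
  by rewrite nth_cat ltnNge leq_addr/= addKn.
split=> [i ia|[s|i l m s] /= ia] /=.
- by have [-> -> ->] := pos i ia; rewrite ia deg_at_cat.
- by rewrite -catA deg_at_cat.
- by have [-> -> ->] := pos i ia; rewrite ia -!catA !deg_at_cat.
Qed.

(* Address, in a tree pointed at the vertex with address a, of the vertex
   mapped to x by the embedding. *)
Definition unloc (a : seq nat) (x : nsv) : seq nat :=
  match x with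
  | R0 s => a ++ s
  | RC i l m s =>
      let p := nth 0%N a (size a - i.+1) in
      take (size a - i.+1) a ++ (if l then p - m.+1 else p + m.+1)%N :: s
  end.

(** Excludes spine indices beyond the root and left siblings that do not exist, for which the
    subtraction in [unloc] would be truncated. *)
Definition loc_ok (a : seq nat) (x : nsv) : bool :=
  if x is RC i l m _ then
    (i < size a)%N && (l ==> (m < nth 0%N a (size a - i.+1))%N)
  else true.

(* Left inverse of [unloc]; [None] on the strict ancestors of a. *)
Fixpoint loc (a s : seq nat) : option nsv :=
  match a, s with
  | [::], _ => Some (R0 s)
  | _ :: _, [::] => None
  | j :: a', l :: s' =>
      if l == j then loc a' s'
      else Some (RC (size a') (l < j)%N
                    (if (l < j)%N then j - l.+1 else l - j.+1)%N s')
  end.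

Lemma odeg_pointed_conf T a x : loc_ok a x ->
  odeg (pointed_conf T a) x = NFin (deg_at (unloc a x) T).
Proof. by case: x => [//|i [] m s] /= /andP[-> //] ->. Qed.

Lemma unloc_cons j a x : loc_ok a x -> unloc (j :: a) x = j :: unloc a x.
Proof.
case: x => [//|i l m s] /= /andP[ia _].
by rewrite subSS -(subnSK ia).
Qed.

Lemma loc_ok_cons j a x : loc_ok a x -> loc_ok (j :: a) x.
Proof.
case: x => [//|i l m s] /= /andP[ia]; rewrite subSS -(subnSK ia)/= => ->.
by rewrite ltnS ltnW.
Qed.

Lemma loc_unloc a s x : loc a s = Some x -> unloc a x = s /\ loc_ok a x.
Proof.
elim: a s => [|j a IH] [|l s] //=; do ?by move=> [<-].
case: eqP => [-> /IH[E ok]|/eqP lj [<-]].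
  by rewrite unloc_cons// E; split=> //; exact: loc_ok_cons.
rewrite /= subSS subnn/= ltnSn/=; case: ltnP => jl /=; split=> //.
- by congr cons; lia.
- lia.
- by congr cons; move/eqP: lj; lia.
Qed.

Lemma unlocK a x : loc_ok a x -> loc a (unloc a x) = Some x.
Proof.
elim: a x => [|j a IH] [s|i l m s] //=; first by rewrite eqxx; exact: (IH (R0 s)).
rewrite subSS ltnS leq_eqVlt => /andP[/predU1P[->|ia]].
  rewrite subnn/=; case: l => [/= mj|_].
    have -> : (j - m.+1 == j)%N = false by apply/eqP; lia.
    have -> : (j - m.+1 < j)%N by lia.
    by congr (Some (RC _ _ _ _)); lia.
  have -> : (j + m.+1 == j)%N = false by apply/eqP; lia.
  have -> : (j + m.+1 < j)%N = false by lia.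
  by congr (Some (RC _ _ _ _)); lia.
rewrite -(subnSK ia)/= eqxx => ok.
by rewrite (IH (RC i l m s))//= ia.
Qed.

Lemma loc_prefix a k : (k < size a)%N -> loc a (take k a) = None.
Proof. by elim: a k => [//|j a IH] [|k] //= ka; rewrite eqxx IH. Qed.

Lemma loc_None a s : loc a s = None ->
  exists2 i, (i < size a)%N & s = take (size a - i.+1) a.
Proof.
elim: a s => [//|j a IH] [|l s] /=.
  by exists (size a) => //; rewrite subSS subnn.
case: eqP => // -> /IH[i ia ->]; exists i; first by rewrite ltnS ltnW.
by rewrite subSS -(subnSK ia).
Qed.

Lemma take_addrs k (a : seq nat) T : a \in addrs T -> take k a \in addrs T.
Proof. by rewrite -{1}(cat_take_drop k a) cat_addrs => /andP[]. Qed.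

Lemma spine_lt T (a : seq nat) i : a \in addrs T -> (i < size a)%N ->
  (nth 0%N a (size a - i.+1) < deg_at (take (size a - i.+1) a) T)%N.
Proof.
by move=> /addrsP aT ia; apply: aT; rewrite ltn_subrL (leq_ltn_trans _ ia).
Qed.

(** The left counts along the spine spell out the address; the outdegrees then determine the tree.
    Hence distinct patterns of the same height exclude each other. *)
Lemma pointed_conf_inj T (a : seq nat) T' (a' : seq nat) : a \in addrs T -> a' \in addrs T' ->
  size a = size a' ->
  agree (size a) (pointed_conf T a) (pointed_conf T' a') -> (T, a) = (T', a').
Proof.
move=> aT aT' saa' [sd od].
have aa' : a = a'.
  apply: (@eq_from_nth _ 0%N) => // j ja; set n := size a in sd saa' ja *.
  have := sd (n - j.+1)%N; rewrite /= -/n -saa'.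
  have -> : (n - j.+1 < n)%N by lia.
  by rewrite (_ : n - _ = j)%N; [move=> /(_ isT)[]|lia].
rewrite -{}aa' in saa' aT' sd od *; congr pair; apply: deg_at_inj => s.
case E : (loc a s) => [x|].
  have [us ok] := loc_unloc E.
  have xa : below (size a) x.
    by case: (x) ok => // i l m r /andP[].
  by have := od x xa; rewrite !odeg_pointed_conf// us => -[].
(* The remaining addresses are strict ancestors, for which the counts to the right agree; [spine_lt]
   ensures that no truncated subtraction hides a difference. *)
have [i ia ->] := loc_None E.
have := sd i ia; rewrite /= ia => -[H].
have := spine_lt aT ia; have := spine_lt aT' ia; move: H; lia.
Qed.

(** * Cylinder events of the random data *)

Lemma In_mem (T : eqType) (x : T) s : List.In x s <-> x \in s.
Proof.
elim: s => [//|y s IH] /=; rewrite inE; split.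
  by move=> [->|/IH ->]; rewrite ?eqxx ?orbT.
by move=> /predU1P[->|/IH]; [left|right].
Qed.

Lemma uniq_NoDup (T : eqType) (s : seq T) : uniq s -> List.NoDup s.
Proof.
elim: s => [|x s IH] /=; first by constructor.
move=> /andP[xs us]; constructor; last exact: IH.
by move=> /In_mem; exact/negP.
Qed.

(** Exploration with [xi] follows T as long as it stays in T and fails at the first step leaving it,
    so the values of [xi] elsewhere are never read. *)
Lemma explored_degree (xi : seq nat -> nat) T s :
  (forall s', s' \in addrs T -> xi s' = deg_at s' T) ->
  (if [forall j : 'I_(size s), (nth 0%N s j < xi (take j s))%N]
   then xi s else 0%N) = deg_at s T.
Proof.
move=> xiE; have [sT|sT] := boolP (s \in addrs T).
  rewrite ifT; first exact: xiE.
  apply/forallP => j; rewrite xiE ?take_addrs//.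
  exact: (addrsP _ _ sT).
rewrite ifF; first by rewrite deg_at_notin.
apply/negP => /forallP H; move/negP: sT; apply.
suff pre k : (k <= size s)%N -> take k s \in addrs T.
  by rewrite -[s]take_size pre.
elim: k => [|k IH] ks; first by rewrite take0 nil_addrs.
rewrite (take_nth 0%N)// rcons_addrs IH ?(ltnW ks)//=.
by rewrite -xiE ?IH ?(ltnW ks)//; exact: (H (Ordinal ks)).
Qed.

(** Here [pmap] discards the strict ancestors of a, whose outdegrees are prescribed through [K] and
    [J] in [pattern_sk]. *)
Definition pattern_sx (T : ptree) (a : seq nat) : seq (nsv * nat) :=
  [seq (x, deg_at (unloc a x) T) | x <- pmap (loc a) (addrs T)].

Definition pattern_sk (T : ptree) (a : seq nat) : seq (nat * (nat * nat)) :=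
  [seq (i, (deg_at (take (size a - i.+1) a) T, nth 0%N a (size a - i.+1)))
  | i <- iota 0 (size a)].

Definition cylinder (Omega : Type) (xi : nsv -> Omega -> nat)
    (K J : nat -> Omega -> nat) (T : ptree) (a : seq nat) : set Omega :=
  [set om | forall p, List.In p (pattern_sx T a) -> xi p.1 om = p.2] `&`
  [set om | forall q, List.In q (pattern_sk T a) ->
              K q.1 om = q.2.1 /\ J q.1 om = q.2.2].

Lemma cylinder_agree (Omega : Type) (xi : nsv -> Omega -> nat)
    (K J : nat -> Omega -> nat) T (a : seq nat) om : a \in addrs T ->
  cylinder xi K J T a om ->
  agree (size a) (star_conf xi K J om) (pointed_conf T a).
Proof.
move=> aT [/= Hx Hk].
have HK i : (i < size a)%N -> K i om = deg_at (take (size a - i.+1) a) T /\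
    J i om = nth 0%N a (size a - i.+1).
  move=> ia; apply: (Hk (i, (_, _))); apply/In_mem/mapP; exists i => //.
  by rewrite mem_iota.
have HX x : loc_ok a x -> unloc a x \in addrs T ->
    xi x om = deg_at (unloc a x) T.
  move=> ok ux; apply: (Hx (x, _)); apply/In_mem/mapP; exists x => //.
  by rewrite mem_pmap -(unlocK ok) map_f.
split=> [i ia|[s|i l m s] xa]; rewrite [LHS]/=.
- by rewrite /= ia; have [-> ->] := HK i ia.
- rewrite odeg_pointed_conf//= deg_at_cat -fun_if.
  rewrite (@explored_degree (fun s => xi (R0 s) om) (subtree a T))// => s' s'a.
  by rewrite (HX (R0 s'))//= ?deg_at_cat// cat_addrs aT.
have {xa} ia : (i < size a)%N := xa.
have [-> ->] := HK i ia; set b := take _ a; set p := nth _ _ _.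
pose c := (if l then p - m.+1 else p + m.+1)%N.
have pb : (p < deg_at b T)%N by exact: spine_lt.
have ucE s' : unloc a (RC i l m s') = rcons b c ++ s' by rewrite cat_rcons.
have [mp|mp] := boolP (m < (if l then p else deg_at b T - p.+1))%N => /=.
  have ok s' : loc_ok a (RC i l m s') by rewrite /= ia/=; case: (l) mp.
  have cb : (c < deg_at b T)%N by rewrite /c; case: (l) mp; lia.
  have bT : rcons b c \in addrs T by rewrite rcons_addrs cb take_addrs.
  rewrite -[RHS]/(odeg (pointed_conf T a) (RC i l m s)).
  rewrite odeg_pointed_conf// ucE deg_at_cat -fun_if.
  rewrite (@explored_degree (fun s => xi (RC i l m s) om) (subtree (rcons b c) T))//.
  by move=> s' s's; rewrite HX ?ucE ?deg_at_cat// cat_addrs bT.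
(* The spine vertex has no such child: on the left [pointed_conf] tests for this, on the right the
   address is not in T and has outdegree 0. *)
rewrite ia; case: l {ucE} @c mp => /= mp.
  by rewrite ifN.
rewrite -/b -/p -cat_rcons deg_at_notin// cat_addrs rcons_addrs.
have -> : (p + m.+1 < deg_at b T)%N = false by lia.
by rewrite andbF.
Qed.

(** At a spine vertex the size bias cancels against the uniform choice of the spine child, k pi_k /
    k = pi_k. So every vertex of T contributes its Galton-Watson factor, whichever vertex is
    pointed. *)
Lemma prob_cylinder (R : realType) (dm : measure_display)
    (Omega : measurableType dm) (P : probability Omega R) (pi : nat -> R)
    (xi : nsv -> Omega -> nat) (K J : nat -> Omega -> nat) T (a : seq nat) :
  star_law P pi xi K J -> a \in addrs T ->
  P (cylinder xi K J T a) = (tweight pi T)%:E.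
Proof.
move=> [_ [_ law]] aT; rewrite /cylinder law.
- congr EFin; rewrite /pattern_sx /pattern_sk !big_map big_pmap.
  rewrite /tweight [RHS](bigID (fun s => loc a s : bool))/=; congr (_ * _).
    rewrite [RHS]big_mkcond; apply: eq_bigr => s _.
    by case E : (loc a s) => [x|]//=; have [->] := loc_unloc E.
  rewrite big_seq (eq_bigr (fun i => pi (deg_at (take (size a - i.+1) a) T))).
    rewrite -big_seq -(big_map (fun i => take (size a - i.+1) a) xpredT
      (fun s => pi (deg_at s T))) -[RHS]big_filter; apply: perm_big.
    apply: uniq_perm; last 1 first.
    + move=> s; rewrite mem_filter; apply/mapP/andP.
        move=> [i]; rewrite mem_iota => /andP[_ ia] ->.
        by rewrite take_addrs// loc_prefix//; lia.
      move=> [E sT]; have [|i ia ->] := @loc_None a s; first by case: loc E.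
      by exists i; rewrite ?mem_iota.
    + rewrite map_inj_in_uniq ?iota_uniq// => i j; rewrite !mem_iota.
      move=> /andP[_ ia] /andP[_ ja] /(congr1 size).
      by rewrite !size_takel ?leq_subr//; set n := size a in ia ja *; lia.
    + by rewrite filter_uniq// addrs_uniq.
  move=> i; rewrite mem_iota => /andP[_ ia] /=; have lt := spine_lt aT ia.
  rewrite lt mulrAC mulfV ?mul1r// pnatr_eq0; lia.
- apply: uniq_NoDup; rewrite -map_comp map_id.
  apply: (@pmap_uniq _ _ _ (unloc a)); last exact: addrs_uniq.
  by move=> s; case E : (loc a s) => [x|]//=; have [] := loc_unloc E.
- by rewrite -map_comp map_id iota_uniq.
Qed.

(** * The limit tree *)

Section DiscreteMeasurability.
Context (dm : measure_display) (Omega : measurableType dm).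

(** Measurability into a discrete space, stated through fibres so that the target carries no
    sigma-algebra. *)
Definition dmeas (C : Type) (g : Omega -> C) : Prop :=
  forall c, measurable (g @^-1` [set c]).

Lemma dmeas_preimage (C : countType) (g : Omega -> C) (Y : set C) :
  dmeas g -> measurable (g @^-1` Y).
Proof.
move=> mg.
have -> : g @^-1` Y = \bigcup_c (if `[< Y c >] then g @^-1` [set c] else set0).
  apply/seteqP; split=> [om Yom|om [c _]]; first by exists (g om); rewrite //= asboolT.
  by case: asboolP => // Yc /= ->.
apply: countable_bigcupT_measurable => [|c]; first exact: countableP.
by case: ifP.
Qed.

Lemma dmeas_comp (C : countType) (C' : Type) (g : Omega -> C) (F : C -> C') :
  dmeas g -> dmeas (F \o g).
Proof. by move=> mg c; rewrite comp_preimage; exact: dmeas_preimage. Qed.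

Lemma dmeas_pair (C C' : Type) (g : Omega -> C) (g' : Omega -> C') :
  dmeas g -> dmeas g' -> dmeas (fun om => (g om, g' om)).
Proof.
move=> mg mg' [c c'].
rewrite (_ : _ @^-1` _ = g @^-1` [set c] `&` g' @^-1` [set c']).
  exact: measurableI.
by apply/seteqP; split=> om /=; [move=> [-> ->]|move=> [-> ->]].
Qed.

Lemma dmeas_mkseq (C : countType) (g : nat -> Omega -> C) n :
  (forall i, dmeas (g i)) -> dmeas (fun om => mkseq (g^~ om) n).
Proof.
move=> mg; elim: n => [|n IH].
  move=> c; rewrite (_ : _ @^-1` _ = if c == [::] then setT else set0).
    by case: ifP.
  apply/seteqP; split=> om /=; first by move=> <-.
  by case: eqP.
rewrite (_ : (fun _ => _) =
    (fun p : seq C * C => rcons p.1 p.2) \o (fun om => (mkseq (g^~ om) n, g n om))).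
  by apply: dmeas_comp; exact: dmeas_pair.
by apply/funext => om; rewrite /= mkseqS.
Qed.

Lemma dmeas_measurable_fun (R : realType) (C : countType) (g : Omega -> C)
    (F : C -> R) : dmeas g -> measurable_fun setT (F \o g).
Proof.
move=> mg _ Y mY; rewrite setTI comp_preimage; exact: dmeas_preimage.
Qed.

Lemma measurable_forall_In (C : Type) (Q : C -> Omega -> Prop) (s : seq C) :
  (forall c, measurable [set om | Q c om]) ->
  measurable [set om | forall c, List.In c s -> Q c om].
Proof.
move=> mQ; elim: s => [|c s IH].
  rewrite (_ : [set _ | _] = setT)//.
  by apply/seteqP; split=> [//|om _ c []].
rewrite (_ : [set _ | _] =
  [set om | Q c om] `&` [set om | forall c, List.In c s -> Q c om]).
  exact: measurableI.
apply/seteqP; split=> om /=.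
  by move=> H; split=> [|c' c's]; apply: H; [left|right].
by move=> [Qc Qs] c' [<-//|/Qs].
Qed.

End DiscreteMeasurability.

Lemma bounded_integrable (R : realType) (dm : measure_display)
    (Omega : measurableType dm) (P : probability Omega R) (g : Omega -> R) (B : R) :
  measurable_fun setT g -> (forall om, `|g om| <= B) ->
  P.-integrable setT (EFin \o g).
Proof.
move=> mg gB; apply: measurable_bounded_integrable => //.
  exact: (le_lt_trans (probability_le1 P measurableT) (ltry _)).
by exists B; split; [exact: num_real|move=> M BM om _; exact: le_trans (gB om) (ltW BM)].
Qed.

Lemma Rintegral_sum_indic (R : realType) (dm : measure_display)
    (Omega : measurableType dm) (P : probability Omega R) (I : Type)
    (A : seq I) (c : I -> R) (G : I -> set Omega) :
  (forall i, measurable (G i)) ->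
  P.-integrable setT (EFin \o (fun om => \sum_(i <- A) c i * \1_(G i) om)) /\
  Rintegral P setT (fun om => \sum_(i <- A) c i * \1_(G i) om) =
  \sum_(i <- A) c i * fine (P (G i)).
Proof.
move=> mG.
have iG i : P.-integrable setT (EFin \o (fun om => \1_(G i) om : R)).
  apply: (@bounded_integrable _ _ _ _ _ 1) => [|om]; first exact/measurable_indicP.
  by rewrite indicE; case: (_ \in _); rewrite ?normr1 ?normr0.
have icG i : P.-integrable setT (EFin \o (fun om => c i * \1_(G i) om)).
  by apply: eq_integrable (integrableZl measurableT (c i) (iG i)) => //= om _.
elim: A => [|i A [IH1 IH2]].
  rewrite big_nil; under eq_fun do rewrite big_nil.
  split; last by rewrite Rintegral_cst// mul0r.
  by apply: (@bounded_integrable _ _ _ _ _ 0) => // om; rewrite normr0.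
rewrite big_cons; under eq_fun do rewrite big_cons.
split; first by apply: eq_integrable (integrableD measurableT (icG i) IH1) => //= om _.
rewrite RintegralD// IH2 RintegralZl//; congr (_ * _ + _).
by rewrite /Rintegral integral_indic// setIT.
Qed.

Section LowerEnvelope.
Context {R : realType} (f : conf -> R).

Definition lower (Q : set conf) : R := inf (f @` Q).

Lemma lower_le Q c : (forall c, 0 <= f c) -> Q c -> lower Q <= f c.
Proof.
move=> f0 Qc; apply: ge_inf; last by exists c.
by exists 0 => _ [c' _ <-].
Qed.

Lemma lower_ge Q b : Q !=set0 -> (forall c, Q c -> b <= f c) -> b <= lower Q.
Proof.
move=> [c Qc] H; apply: lb_le_inf; first by exists (f c), c.
by move=> _ [c' Qc' <-]; exact: H.
Qed.

End LowerEnvelope.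

(** * Finite approximation of configurations *)

Definition nsv_code (x : nsv) : nat :=
  pickle (match x with
          | R0 s => inl s
          | RC i l m s => inr (i, l, m, s)
          end : seq nat + nat * bool * nat * seq nat).

Definition nsv_decode (n : nat) : option nsv :=
  match unpickle n : option (seq nat + nat * bool * nat * seq nat) with
  | Some (inl s) => Some (R0 s)
  | Some (inr (i, l, m, s)) => Some (RC i l m s)
  | None => None
  end.

Lemma nsv_codeK : pcancel nsv_code nsv_decode.
Proof. by case=> [s|i l m s]; rewrite /nsv_decode /nsv_code pickleK. Qed.

Lemma codes_below m :
  exists2 h, (m <= h)%N & forall x, (nsv_code x < m)%N -> below h x.
Proof.
elim: m => [|m [h mh IH]]; first by exists 0%N.
exists (h.+1 + (if nsv_decode m is Some (RC i _ _ _) then i else 0%N))%N.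
  by rewrite addSn ltnS (leq_trans mh)// leq_addr.
move=> x; rewrite ltnS leq_eqVlt => /predU1P[E|/IH].
  by rewrite -E nsv_codeK; case: x {E} => //= i l k s; rewrite addSn ltnS leq_addl.
by case: x => //= i l k s ih; rewrite addSn ltnS ltnW// ltn_addr.
Qed.

(** The list [v.1] holds the left and right counts along the spine, and [v.2] the other outdegrees,
    indexed by the codes of the vertices. *)
Definition compat (m : nat) (v : seq (nat * nat) * seq nat) (c : conf) : Prop :=
  (forall i, (i < m)%N ->
     sdeg c i = SPair (NFin (nth (0, 0)%N v.1 i).1)
                      (NFin (nth (0, 0)%N v.1 i).2)) /\
  (forall x, (nsv_code x < m)%N -> odeg c x = NFin (nth 0%N v.2 (nsv_code x))).

Section LimitTree.
Context (R : realType) (dm : measure_display) (Omega : measurableType dm).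
Variables (P : probability Omega R) (p : nat -> R).
Variables (xi : nsv -> Omega -> nat) (K J : nat -> Omega -> nat).
Hypothesis law : star_law P p xi K J.

Let star := star_conf xi K J.

Definition star_odeg (x : nsv) (om : Omega) : nat :=
  if odeg (star_conf xi K J om) x is NFin k then k else 0%N.

Lemma star_odegE x om : odeg (star om) x = NFin (star_odeg x om).
Proof. by rewrite /star_odeg; case: x => [s|i l m s] /=; case: ifP. Qed.

Let dmeas_xi x : dmeas (xi x).
Proof. by move=> a; have [mx _] := law; exact: mx. Qed.

Let dmeas_KJ i : dmeas (fun om => (K i om, J i om)).
Proof.
move=> [k j]; have [_ [mk _]] := law.
rewrite (_ : _ @^-1` _ = [set om | K i om = k /\ J i om = j])//.
by apply/seteqP; split=> om /=; [move=> [-> ->]|move=> [-> ->]].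
Qed.

(** The outdegree depends on finitely many discrete variables: [xi] along the prefixes of the
    address and, off the spine, one pair (K, J). *)
Lemma dmeas_star_odeg x : dmeas (star_odeg x).
Proof.
pose F s (v : seq nat) := if [forall j : 'I_(size s), (nth 0 s j < nth 0 v j)%N]
  then nth 0%N v (size s) else 0%N.
have FE s (u : seq nat -> nat) : F s (mkseq (fun j => u (take j s)) (size s).+1) =
    if [forall j : 'I_(size s), (nth 0 s j < u (take j s))%N] then u s else 0%N.
  rewrite /F nth_mkseq// take_size; congr (if _ then _ else _).
  by apply: eq_forallb => j; rewrite nth_mkseq// ltnS ltnW.
case: x => [s|i l m s].
  rewrite (_ : star_odeg _ =
    F s \o (fun om => mkseq (fun j => xi (R0 (take j s)) om) (size s).+1)).
    by apply: dmeas_comp; apply: dmeas_mkseq.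
  apply/funext => om; rewrite /= (FE s (fun s => xi (R0 s) om)) /star_odeg /=.
  by case: ifP.
pose G (v : (nat * nat) * seq nat) :=
  if (m < (if l then v.1.2 else v.1.1 - v.1.2.+1))%N then F s v.2 else 0%N.
rewrite (_ : star_odeg _ = G \o (fun om => ((K i om, J i om),
    mkseq (fun j => xi (RC i l m (take j s)) om) (size s).+1))).
  by apply: dmeas_comp; apply: dmeas_pair => //; apply: dmeas_mkseq.
apply/funext => om; rewrite /= /G/= (FE s (fun s => xi (RC i l m s) om)) /star_odeg /=.
by case: ltnP => //= _; case: ifP.
Qed.

Definition star_values (m : nat) (om : Omega) : seq (nat * nat) * seq nat :=
  (mkseq (fun i => (J i om, K i om - (J i om).+1)%N) m,
   mkseq (fun j => if nsv_decode j is Some x then star_odeg x om else 0%N) m).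

Lemma dmeas_star_values m : dmeas (star_values m).
Proof.
apply: dmeas_pair; apply: dmeas_mkseq => i.
  rewrite (_ : (fun _ => _) = (fun q : nat * nat => (q.2, q.1 - q.2.+1)%N) \o
    (fun om => (K i om, J i om)))//.
  exact: dmeas_comp.
case: (nsv_decode i) => [x|]; first exact: dmeas_star_odeg.
move=> c; rewrite (_ : _ @^-1` _ = if c == 0%N then setT else set0).
  by case: ifP.
apply/seteqP; split=> om /=; first by move=> <-.
by case: eqP.
Qed.

Lemma star_compat m om : compat m (star_values m om) (star om).
Proof.
split=> [i im|x xm]; first by rewrite /= nth_mkseq.
by rewrite star_odegE /= nth_mkseq// nsv_codeK.
Qed.

Lemma measurable_cylinder T a : measurable (cylinder xi K J T a).
Proof.
have [mx [mk _]] := law.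
by apply: measurableI; apply: measurable_forall_In.
Qed.

Section ContinuousFunction.
Variables (f : conf -> R) (B : R).
Hypotheses (cf : conf_continuous f) (f0 : forall c, 0 <= f c)
  (fB : forall c, f c <= B).

(** A function of finitely many discrete values, hence measurable, which approximates [f] on the
    limit tree from below. It gives both the measurability of [f] along [star_conf] and a quantity
    comparable with finite patterns. *)
Definition star_lower (m : nat) (om : Omega) : R :=
  lower f (compat m (star_values m om)).

Lemma star_lower_le m om : star_lower m om <= f (star om).
Proof. by apply: lower_le => //; exact: star_compat. Qed.

Lemma star_lower_ge0 m om : 0 <= star_lower m om.
Proof.
by apply: lower_ge => [|c _]; [exists (star om); exact: star_compat|exact: f0].
Qed.

(** Continuity involves finitely many coordinates; once m exceeds their indices and codes, every
    compatible configuration lies in the given neighbourhood. *)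
Lemma cvg_star_lower om : star_lower m om @[m --> \oo] --> f (star om).
Proof.
apply/cvgrPdist_le => eps eps0.
have [I [X [M HM]]] := cf (star om) eps0.
near=> m.
rewrite ger0_norm ?subr_ge0 ?star_lower_le// lerBlDr addrC -lerBlDr.
apply: lower_ge; first by exists (star om); exact: star_compat.
move=> c [cs co]; have [ss so] := star_compat m om.
rewrite lerBlDr -lerBlDl; apply: le_trans (ler_norm _) _; rewrite distrC.
apply/ltW/HM => [i /In_mem iI|x /In_mem xX].
  have im : (i < m)%N.
    apply: leq_trans (_ : (\max_(i <- I) i).+1 <= m)%N; last by near: m; exact: nbhs_infty_ge.
    by rewrite ltnS; apply: (@leq_bigmax_seq _ _ _ id).
  by rewrite ss// cs.
have xm : (nsv_code x < m)%N.
  apply: leq_trans (_ : (\max_(x <- X) nsv_code x).+1 <= m)%N; last by near: m; exact: nbhs_infty_ge.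
  by rewrite ltnS; apply: (@leq_bigmax_seq _ _ _ nsv_code).
by rewrite so// co.
Unshelve. all: by end_near.
Qed.

Lemma measurable_star_lower m : measurable_fun setT (star_lower m).
Proof.
apply: (@dmeas_measurable_fun _ _ _ _ _ (fun v => lower f (compat m v))).
exact: dmeas_star_values.
Qed.

Lemma measurable_f_star : measurable_fun setT (f \o star).
Proof.
apply/measurable_EFinP.
apply: (emeasurable_fun_cvg (fun m om => (star_lower m om)%:E)) => [m|om _].
  by apply/measurable_EFinP; exact: measurable_star_lower.
by apply: cvg_EFin; [exact: nearW|exact: cvg_star_lower].
Qed.

Lemma f_star_integrable : P.-integrable setT (EFin \o (f \o star)).
Proof.
apply: (@bounded_integrable _ _ _ _ _ B); first exact: measurable_f_star.
by move=> om; rewrite /= ger0_norm ?f0 ?fB.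
Qed.

Lemma star_lower_integrable m : P.-integrable setT (EFin \o star_lower m).
Proof.
apply: (@bounded_integrable _ _ _ _ _ B); first exact: measurable_star_lower.
by move=> om; rewrite ger0_norm ?star_lower_ge0// (le_trans (star_lower_le m om)).
Qed.

Lemma cvg_int_star_lower :
  Rintegral P setT (star_lower m) @[m --> \oo] --> Rintegral P setT (f \o star).
Proof.
have cvg_ae : {ae P, forall om, setT om ->
    (star_lower m om)%:E @[m --> \oo] --> (EFin \o (f \o star)) om}.
  by apply: aeW => om _; apply: cvg_EFin; [exact: nearW|exact: cvg_star_lower].
have iB : P.-integrable setT (cst B%:E).
  by apply: (@bounded_integrable _ _ _ _ (cst B) `|B|).
have dom : {ae P, forall om m, setT om ->
    (`|(star_lower m om)%:E| <= cst B%:E om)%E}.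
  apply: aeW => om m _; rewrite lee_fin ger0_norm ?star_lower_ge0//.
  by rewrite (le_trans (star_lower_le m om)).
have [_ _ H] := dominated_convergence measurableT
  (fun m => measurable_int _ (star_lower_integrable m))
  (measurable_int _ f_star_integrable) cvg_ae iB dom.
apply: fine_cvg; rewrite fineK; first exact: H.
by apply: integrable_fin_num => //; exact: f_star_integrable.
Qed.

Definition pattern_lower (q : ptree * seq nat) : R :=
  lower f (fun c => agree (size q.2) c (pointed_conf q.1 q.2)).

(** The cylinders of the patterns are disjoint. On that of q, agreement below u_h fixes the first m
    values, so [star_lower m] is at most [pattern_lower q]; on the uncovered event it is at most
    B. *)
Lemma int_star_lower_le m h (A : seq (ptree * seq nat)) : (m <= h)%N ->
  (forall x, (nsv_code x < m)%N -> below h x) -> uniq A ->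
  (forall q, q \in A -> q.2 \in addrs q.1 /\ size q.2 = h) ->
  Rintegral P setT (star_lower m) <=
  \sum_(q <- A) pattern_lower q * tweight p q.1 +
  B * (1 - \sum_(q <- A) tweight p q.1).
Proof.
move=> mh mx uA HA.
pose G q := cylinder xi K J q.1 q.2.
(* Chosen so that [star_lower m + S <= B] holds pointwise; integrating this gives the claim. *)
pose S om := \sum_(q <- A) (B - pattern_lower q) * \1_(G q) om.
have mG q : measurable (G q) by exact: measurable_cylinder.
have [iS intS] := @Rintegral_sum_indic _ _ _ P _ A (fun q => B - pattern_lower q) G mG.
have iL := star_lower_integrable m.
have B0 om : 0 <= B - star_lower m om.
  by rewrite subr_ge0 (le_trans (star_lower_le m om)).
have le1 : Rintegral P setT (fun om => star_lower m om + S om) <= B.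
  rewrite -[leRHS](_ : Rintegral P setT (cst B) = B); last first.
    rewrite Rintegral_cst// -[RHS]mulr1; congr (_ * _).
    by rewrite -[RHS]/(fine (1%E : \bar R)); congr fine; exact: probability_setT.
  apply: le_Rintegral => //.
  - by apply: eq_integrable (integrableD measurableT iL iS) => //= om _.
  - by apply: (@bounded_integrable _ _ _ _ _ `|B|).
  move=> om _; rewrite -lerBrDl.
  under [leLHS]eq_bigr do rewrite indicE.
  apply: (@sum_indicator_le _ _ A (fun q => om \in G q)) => //.
    move=> q q' qA q'A; rewrite !inE => Gq Gq'.
    have [aq sq] := HA q qA; have [aq' sq'] := HA q' q'A.
    rewrite [q]surjective_pairing [q']surjective_pairing.
    apply: pointed_conf_inj => //; first by rewrite sq sq'.
    apply: agree_trans (agree_sym (cylinder_agree aq Gq)) _.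
    by rewrite sq -sq'; exact: cylinder_agree.
  move=> q qA; rewrite inE => Gq; rewrite lerD2l lerN2.
  have [aq sq] := HA q qA.
  apply: lower_ge; first by exists (pointed_conf q.1 q.2); split.
  move=> c cq; apply: lower_le => //.
  have [cs co] := agree_trans cq (agree_sym (cylinder_agree aq Gq)).
  have [ss so] := star_compat m om.
  split=> [i im|x xm].
    by rewrite cs ?sq ?(leq_trans im)// ss.
  by rewrite co ?sq ?mx// so.
move: le1; rewrite RintegralD// intS.
rewrite (eq_big_seq (fun q => B * tweight p q.1 - pattern_lower q * tweight p q.1)).
  by rewrite sumrB -big_distrr/=; lra.
move=> q qA; have [aq _] := HA q qA.
by rewrite /G (prob_cylinder law aq) mulrBl.
Qed.

End ContinuousFunction.
End LimitTree.

(** * Convergence *)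

Section Convergence.
Variable R : realType.
Implicit Types (w p : nat -> R) (f : conf -> R).

Definition patterns (h N : nat) : seq (ptree * seq nat) :=
  [seq (T, a) | T <- box N, a <- [seq a <- addrs T | size a == h]].

Lemma patterns_uniq h N : uniq (patterns h N).
Proof.
apply: allpairs_uniq_dep => [|T _|]; first exact: box_uniq.
  by rewrite filter_uniq// addrs_uniq.
by move=> [T a] [T' a'] _ _ /= [-> ->].
Qed.

Lemma mem_patterns h N q : q \in patterns h N ->
  q.2 \in addrs q.1 /\ size q.2 = h.
Proof.
move=> /allpairsPdep[T [a [_ + ->]]]; rewrite mem_filter => /andP[/eqP sa aT].
by [].
Qed.

Lemma sum_patterns p h N :
  \sum_(q <- patterns h N) tweight p q.1 = width_mass p h N.
Proof.
rewrite big_allpairs_dep/=; apply: eq_bigr => T _.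
rewrite big_filter big_const_seq iter_addr_0 mulr_natr; congr (_ *+ _).
by rewrite /width -sum1_count big_mkcond.
Qed.

(** Appending the address of the pointed vertex sends the root of each copy injectively to a vertex
    with the given extended fringe. *)
Lemma ncopies_le_matches h T (q : ptree * seq nat) :
  q.2 \in addrs q.1 -> size q.2 = h ->
  (ncopies q.1 T <= \sum_(b <- addrs T)
     [&& h <= size b, subtree (take (size b - h) b) T == q.1
       & drop (size b - h) b == q.2])%N.
Proof.
move=> aq sq.
pose mtc (b : seq nat) := [&& h <= size b,
  subtree (take (size b - h) b) T == q.1 & drop (size b - h) b == q.2]%N.
rewrite /ncopies -[leqLHS](big_mkcond (fun s => subtree s T == q.1) (fun=> 1%N)).
rewrite -[leqRHS](big_mkcond mtc (fun=> 1%N)) !sum1_count -!size_filter.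
rewrite -(size_map (cat^~ q.2)); apply: uniq_leq_size.
  rewrite map_inj_uniq ?filter_uniq ?addrs_uniq// => s s' E.
  by have /eqP := E; rewrite eqseq_cat; [move=> /andP[/eqP]|
    move: (congr1 size E); rewrite !size_cat => /addIn].
move=> b /mapP[s]; rewrite mem_filter => /andP[/eqP sT saT] ->.
rewrite mem_filter cat_addrs saT sT aq andbT /mtc size_cat sq addnK leq_addl.
by rewrite take_size_cat// drop_size_cat// sT !eqxx.
Qed.

Lemma pattern_lower_ge0 f q : (forall c, 0 <= f c) -> 0 <= pattern_lower f q.
Proof.
move=> f0; apply: lower_ge => [|c _]; last exact: f0.
by exists (pointed_conf q.1 q.2).
Qed.

(** Each vertex of T realises at most one pattern of height h, and there [f] is at least the infimum
    over that pattern. *)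
Lemma sum_pointed_ge f h (A : seq (ptree * seq nat)) T :
  (forall c, 0 <= f c) -> uniq A ->
  (forall q, q \in A -> q.2 \in addrs q.1 /\ size q.2 = h) ->
  \sum_(q <- A) pattern_lower f q * (ncopies q.1 T)%:R <=
  \sum_(b <- addrs T) f (pointed_conf T b).
Proof.
move=> f0 uA HA.
pose mtc (b : seq nat) (q : ptree * seq nat) :=
  [&& (h <= size b)%N, subtree (take (size b - h) b) T == q.1
    & drop (size b - h) b == q.2].
apply: (@le_trans _ _ (\sum_(q <- A) \sum_(b <- addrs T)
    pattern_lower f q * (mtc b q)%:R)).
  rewrite big_seq [leRHS]big_seq; apply: ler_sum => q qA; have [aq sq] := HA q qA.
  rewrite -big_distrr/= ler_wpM2l ?pattern_lower_ge0// -natr_sum ler_nat.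
  exact: ncopies_le_matches.
rewrite exchange_big/=; apply: ler_sum => b _; apply: sum_indicator_le => //.
  move=> q q' _ _ /and3P[_ /eqP e1 /eqP e2] /and3P[_ /eqP e3 /eqP e4].
  by rewrite [q]surjective_pairing [q']surjective_pairing -e1 -e2 -e3 -e4.
move=> q qA /and3P[_ /eqP e1 /eqP e2]; apply: lower_le => //.
rewrite -{1}[b](cat_take_drop (size b - h)) e2 -e1.
exact: agree_pointed_conf.
Qed.

Lemma Tn_expect_ge p n f h (A : seq (ptree * seq nat)) (e : R) :
  (forall k, 0 <= p k) -> (forall c, 0 <= f c) -> uniq A ->
  (forall q, q \in A -> q.2 \in addrs q.1 /\ size q.2 = h) ->
  (0 < n)%N -> 0 < zn p n ->
  (forall q, q \in A -> (tweight p q.1 - e) * n%:R * zn p n <=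
     \sum_(T <- trees_of_size n) tweight p T * (ncopies q.1 T)%:R) ->
  \sum_(q <- A) pattern_lower f q * (tweight p q.1 - e) <= Tn_expect p n f.
Proof.
move=> p0 f0 uA HA n0 z0 HN; rewrite /Tn_expect -/(zn p n) ler_pdivlMr//.
have n0' : 0 < n%:R :> R by rewrite ltr0n.
apply: (@le_trans _ _ (\sum_(T <- trees_of_size n) tweight p T *
    (n%:R^-1 * \sum_(q <- A) pattern_lower f q * (ncopies q.1 T)%:R))); last first.
  apply: ler_sum => T _; rewrite ler_wpM2l ?tweight_ge0// ler_wpM2l ?invr_ge0//.
  exact: (@sum_pointed_ge f h).
rewrite [leRHS](_ : _ = n%:R^-1 * \sum_(q <- A) pattern_lower f q *
    \sum_(T <- trees_of_size n) tweight p T * (ncopies q.1 T)%:R); last first.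
  transitivity (\sum_(T <- trees_of_size n) n%:R^-1 *
      \sum_(q <- A) pattern_lower f q * (tweight p T * (ncopies q.1 T)%:R)).
    apply: eq_bigr => T _; rewrite mulrCA big_distrr/=; congr (_ * _).
    by apply: eq_bigr => q _; rewrite mulrCA.
  rewrite -big_distrr/= exchange_big/=; congr (_ * _).
  by apply: eq_bigr => q _; rewrite big_distrr.
rewrite ler_pdivlMl// big_distrl big_distrr/= big_seq [leRHS]big_seq.
apply: ler_sum => q qA.
apply: le_trans (ler_wpM2l (pattern_lower_ge0 q f0) (HN q qA)).
by rewrite le_eqVlt; apply/orP; left; apply/eqP; ring.
Qed.

Lemma ncopies_mean_ge_all p d (A : seq ptree) (e : R) :
  critical p -> is_span p d -> 0 < e ->
  exists N, forall n, (N <= n)%N -> n = 1%N %[mod d] ->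
    forall tau, tau \in A -> (tweight p tau - e) * n%:R * zn p n <=
      \sum_(T <- trees_of_size n) tweight p T * (ncopies tau T)%:R.
Proof.
move=> cp sp e0; elim: A => [|tau A [N IH]]; first by exists 0%N.
have [N' HN'] := ncopies_mean_ge tau cp sp e0.
exists (maxn N N') => n; rewrite geq_max => /andP[Nn N'n] nd t.
by rewrite inE => /predU1P[->|]; [exact: HN'|exact: IH].
Qed.

Lemma zn_gt0 p d : critical p -> is_span p d ->
  exists N, forall n, (N <= n)%N -> n = 1%N %[mod d] -> 0 < zn p n.
Proof.
move=> cp sp; have [N HN] := zn_subexp cp sp ltr01.
by exists N => n Nn nd; apply: lt_le_trans (HN n Nn nd); exact: expR_gt0.
Qed.

Lemma Tn_expect_liminf p d (dm : measure_display) (Omega : measurableType dm)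
    (P : probability Omega R) (xi : nsv -> Omega -> nat)
    (K J : nat -> Omega -> nat) f (B eps : R) :
  critical p -> is_span p d -> star_law P p xi K J -> conf_continuous f ->
  (forall c, 0 <= f c) -> (forall c, f c <= B) -> 0 < eps ->
  exists N, forall n, (N <= n)%N -> n = 1%N %[mod d] ->
    Rintegral P setT (f \o star_conf xi K J) - eps <= Tn_expect p n f.
Proof.
move=> cp sp law cf f0 fB eps0; have [p0 _ _ _ _] := cp.
have B0 : 0 <= B.
  pose c0 := pointed_conf (Node [::]) [::].
  exact: le_trans (f0 c0) (fB c0).
(* One e each goes to replacing [f] by [star_lower m], to the mass not covered by the patterns, and
   to the error in the fringe frequencies. *)
have [e e0 epsE] : exists2 e : R, 0 < e & eps = e + e + e by exists (eps / 3); lra.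
have /cvgrPdist_le/(_ e e0)[m _ Hm] := cvg_int_star_lower law cf f0 fB.
have {Hm} Hm : Rintegral P setT (f \o star_conf xi K J) - e <=
    Rintegral P setT (star_lower xi K J f m).
  by have := le_trans (ler_norm _) (Hm m (leqnn _)); lra.
(* The height h is such that agreement below u_h determines the first m recorded values. *)
have [h mh hx] := codes_below m.
have B1 : 0 < B + 1 by lra.
have [N0 HN0] := width_mass_ge h cp (divr_gt0 e0 B1).
set A := patterns h N0.
have Hint := int_star_lower_le law f0 fB mh hx (patterns_uniq h N0)
  (@mem_patterns h N0).
set C := \sum_(q <- A) pattern_lower f q.
have C0 : 0 <= C by apply: sumr_ge0 => q _; exact: pattern_lower_ge0.
have C1 : 0 < C + 1 by lra.
have [N1 HN1] := ncopies_mean_ge_all [seq q.1 | q <- A] cp sp (divr_gt0 e0 C1).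
have [N2 HN2] := zn_gt0 cp sp.
exists (maxn 1 (maxn N1 N2)) => n; rewrite !geq_max => /and3P[n1 N1n N2n] nd.
have := @Tn_expect_ge p n f h A (e / (C + 1)) p0 f0 (patterns_uniq h N0)
  (@mem_patterns h N0) n1 (HN2 n N2n nd) _.
have HA q : q \in A -> (tweight p q.1 - e / (C + 1)) * n%:R * zn p n <=
     \sum_(T <- trees_of_size n) tweight p T * (ncopies q.1 T)%:R.
  by move=> qA; apply: (HN1 n N1n nd); exact: map_f.
move=> /(_ HA); apply: le_trans.
under eq_bigr do rewrite mulrBr.
rewrite sumrB -big_distrl/= -/C.
have CE : C * (e / (C + 1)) <= e.
  rewrite mulrCA ler_piMr ?(ltW e0)// ler_pdivrMr//; lra.
have BE : B * (1 - width_mass p h N0) <= e.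
  apply: (@le_trans _ _ (B * (e / (B + 1)))); first by rewrite ler_wpM2l//; lra.
  by rewrite mulrCA ler_piMr ?(ltW e0)// ler_pdivrMr//; lra.
move: Hint; rewrite sum_patterns -/A; lra.
Qed.

(** * Reduction to the critical offspring law *)

Lemma sum_deg_at T : (\sum_(s <- addrs T) deg_at s T).+1 = tsize T.
Proof.
elim/ptree_ind_mem: T => ts IH.
rewrite tsize_node (@big_addrs _ _ _ _ _ (fun t s => deg_at s t)); last first.
  by move=> i s _; rewrite deg_at_cons.
congr S; rewrite /= -sum1_size -big_split/= big_seq [RHS]big_seq.
by apply: eq_bigr => t /IH <-.
Qed.

(** The outdegrees add up to the number of edges, so tilting changes the weight by a factor
    depending on the size only and leaves the law of T_n unchanged. *)
Lemma tweight_pi_w w (tau : R) T : tweight (pi_w w tau) T =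
  tau ^+ (tsize T).-1 / phi w tau ^+ tsize T * tweight w T.
Proof.
rewrite -{1}(sum_deg_at T)/= (big_morph (fun n => tau ^+ n) (exprD tau) (expr0 tau)).
rewrite /tweight !big_split/= mulrAC; congr (_ * _).
by rewrite big_const_seq count_predT iter_mulr_1 exprVn.
Qed.

Lemma Tn_expect_pi_w w (tau : R) n f : tau != 0 -> phi w tau != 0 ->
  Tn_expect (pi_w w tau) n f = Tn_expect w n f.
Proof.
move=> tau0 phi0.
set c := tau ^+ n.-1 / phi w tau ^+ n.
have c0 : c != 0 by rewrite mulf_neq0 ?invr_eq0 ?expf_neq0.
have wE (g : ptree -> R) :
    \sum_(T <- trees_of_size n) tweight (pi_w w tau) T * g T =
    c * \sum_(T <- trees_of_size n) tweight w T * g T.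
  rewrite big_distrr/= big_seq [RHS]big_seq; apply: eq_bigr => T.
  by rewrite mem_trees_of_size tweight_pi_w => /eqP ->; rewrite -mulrA.
have zE : \sum_(T <- trees_of_size n) tweight (pi_w w tau) T =
    c * \sum_(T <- trees_of_size n) tweight w T.
  transitivity (\sum_(T <- trees_of_size n) tweight (pi_w w tau) T * 1).
    by apply: eq_bigr => T _; rewrite mulr1.
  by rewrite wE; congr (_ * _); apply: eq_bigr => T _; rewrite mulr1.
by rewrite /Tn_expect zE wE -mulf_div divff// mul1r.
Qed.

Lemma Tn_expect_affine p n f (a b : R) : (0 < n)%N -> 0 < zn p n ->
  Tn_expect p n (fun c => a * f c + b) = a * Tn_expect p n f + b.
Proof.
move=> n0 z0; rewrite /Tn_expect -/(zn p n).
have n0' : n%:R != 0 :> R by rewrite pnatr_eq0 -lt0n.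
rewrite -[X in _ = _ + X](mulfK (lt0r_neq0 z0)) mulrA -mulrDl; congr (_ / _).
rewrite /zn !big_distrr -big_split/= big_seq [RHS]big_seq.
apply: eq_bigr => T; rewrite mem_trees_of_size => /eqP Tn.
rewrite big_split/= -big_distrr/= big_const_seq count_predT iter_addr_0.
rewrite -/(tsize T) Tn -mulr_natr; field.
by [].
Qed.

Lemma phi_gt0 w (tau : R) : weight_seq w -> is_tau w tau -> 0 < phi w tau.
Proof.
move=> [w0 [ww0 _]] [tau0 [cphi _]]; apply: lt_le_trans ww0 _.
have nd : nondecreasing_seq (phi_series w tau).
  by apply/nondecreasing_seqP => m; rewrite /phi_series seriesSr lerDl mulr_ge0// exprn_ge0// ltW.
have := nondecreasing_cvgn_le nd cphi 1%N.
by rewrite /phi_series /series/= big_nat1 expr0 mulr1.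
Qed.

Lemma critical_pi_w w (tau : R) : weight_seq w -> is_tau w tau ->
  critical (pi_w w tau).
Proof.
move=> hw htau; have phi0 := phi_gt0 hw htau.
have [w0 [ww0 [k2 [k2_ge2 wk2]]]] := hw.
have [tau0 [cphi [cdphi psi1]]] := htau.
split.
- by move=> k; rewrite /pi_w mulr_ge0 ?invr_ge0 ?(ltW phi0)// mulr_ge0// exprn_ge0// ltW.
- by rewrite /pi_w expr0 mul1r divr_gt0.
- by exists k2 => //; rewrite /pi_w divr_gt0// mulr_gt0// exprn_gt0.
- have -> : series (pi_w w tau) = (fun n => phi_series w tau n * (phi w tau)^-1).
    apply/funext => n; rewrite /phi_series /series/= big_distrl/=.
    by apply: eq_bigr => k _; rewrite /pi_w [w k * _]mulrC.
  rewrite -(mulfV (lt0r_neq0 phi0)).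
  by apply: cvgM; [exact: cphi|exact: cvg_cst].
- have -> : series (fun k => k%:R * pi_w w tau k) =
      (fun n => (tau / phi w tau) * dphi_series w tau n).
    apply/funext => n; rewrite /dphi_series /series/= big_distrr/=.
    apply: eq_bigr => -[|k] _; first by rewrite !mul0r mulr0.
    by rewrite /pi_w /= exprS; ring.
  (* The mean of [pi_w w tau] is psi(tau), which is 1 by the choice of tau. *)
  rewrite -psi1 /psi [tau * _ / _]mulrAC.
  by apply: cvgM; [exact: cvg_cst|exact: cdphi].
Qed.

Lemma is_span_pi_w w d (tau : R) : 0 < tau -> 0 < phi w tau -> is_span w d ->
  is_span (pi_w w tau) d.
Proof.
move=> tau0 phi0.
have piE i : (0 < pi_w w tau i) = (0 < w i).
  by rewrite /pi_w pmulr_lgt0 ?invr_gt0// pmulr_rgt0// exprn_gt0.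
move=> [dw gw]; split=> [i|d' Hd']; first by rewrite piE; exact: dw.
by apply: gw => i; rewrite -piE; exact: Hd'.
Qed.

Lemma conf_continuous_affine f (a b : R) : `|a| = 1 -> conf_continuous f ->
  conf_continuous (fun c => a * f c + b).
Proof.
move=> a1 cf c eps eps0; have [I [X [M H]]] := cf c eps eps0.
exists I, X, M => c' HI HX.
rewrite (_ : _ - _ = a * (f c' - f c)); last by ring.
by rewrite normrM a1 mul1r; exact: H.
Qed.

(** The sign a is 1 or -1. Adding B to a f makes it nonnegative and bounded by 2B, as
    [Tn_expect_liminf] demands, and both expectations undo the affine change. *)
Lemma Tn_expect_one_sided p d (dm : measure_display)
    (Omega : measurableType dm) (P : probability Omega R)
    (xi : nsv -> Omega -> nat) (K J : nat -> Omega -> nat) f (B a eps : R) :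
  critical p -> is_span p d -> star_law P p xi K J -> conf_continuous f ->
  (forall c, `|f c| <= B) -> `|a| = 1 -> a * a = 1 -> 0 < eps ->
  exists N, forall n, (N <= n)%N -> n = 1%N %[mod d] ->
    a * Rintegral P setT (f \o star_conf xi K J) - eps <= a * Tn_expect p n f.
Proof.
move=> cp sp law cf fB a1 aa eps0; set g := fun c => a * f c + B.
have afB c : `|a * f c| <= B by rewrite normrM a1 mul1r.
have g0 c : 0 <= g c by have := afB c; rewrite ler_norml /g; lra.
have gB c : g c <= B + B by have := afB c; rewrite ler_norml /g; lra.
have cg : conf_continuous g by exact: conf_continuous_affine.
have [N HN] := Tn_expect_liminf cp sp law cg g0 gB eps0.
have [N' HN'] := zn_gt0 cp sp.
exists (maxn 1 (maxn N N')) => n; rewrite !geq_max => /and3P[n1 Nn N'n] nd.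
have := HN n Nn nd; rewrite Tn_expect_affine ?HN'//.
have ig := f_star_integrable law cg g0 gB.
have iB : P.-integrable setT (EFin \o (fun=> B)).
  by apply: (@bounded_integrable _ _ _ _ _ `|B|).
have -> : f \o star_conf xi K J =
    (fun om => a * ((g \o star_conf xi K J) om - B)).
  by apply/funext => om; rewrite /= /g addrK mulrA aa mul1r.
rewrite RintegralZl//; last first.
  by apply: eq_integrable (integrableB measurableT ig iB) => //= om _.
rewrite mulrA aa mul1r RintegralB// Rintegral_cst//.
rewrite (_ : fine _ = 1); last first.
  by rewrite -[RHS]/(fine (1%E : \bar R)); congr fine; exact: probability_setT.
by rewrite mulr1; lra.
Qed.

End Convergence.

Theorem theorem5p1 (R : realType) (w : nat -> R) (d : nat) (tau : R)
  (dm : measure_display) (Omega : measurableType dm) (P : probability Omega R)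
  (xi : nsv -> Omega -> nat) (K J : nat -> Omega -> nat) :
  weight_seq w -> is_span w d -> typeI w -> is_tau w tau ->
  star_law P (pi_w w tau) xi K J ->
  conv_in_dist w d
    (fun f => fine (\int[P]_om (f (star_conf xi K J om))%:E)).
Proof.
move=> hw hd _ htau law f cf [B fB] eps eps0.
have phi0 := phi_gt0 hw htau; have [tau0 _] := htau.
have cp := critical_pi_w hw htau.
have sp := is_span_pi_w tau0 phi0 hd.
have e0 : 0 < eps / 2 by rewrite divr_gt0.
(* The signs 1 and -1 give the lower and the upper bound, each with error eps / 2 so that the final
   inequality is strict. *)
have [N1 H1] := Tn_expect_one_sided cp sp law cf fB (normr1 R) (mulr1 1) e0.
have NN : -1 * -1 = 1 :> R by rewrite mulrNN mulr1.
have [N2 H2] := Tn_expect_one_sided cp sp law cf fB (normrN1 R) NN e0.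
exists (maxn N1 N2) => n; rewrite geq_max => /andP[N1n N2n] nd.
have := H1 n N1n nd; have := H2 n N2n nd.
rewrite !Tn_expect_pi_w ?gt_eqF//.
rewrite -[fine _]/(Rintegral P setT (f \o star_conf xi K J)).
move: (Rintegral _ _ _) (Tn_expect _ _ _) => E t le1 le2.
by rewrite ltr_norml; apply/andP; split; lra.
Qed.
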